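(* Let $\gamma:K^*\to K$ be a non-degenerate simplicial dynamical system on an everywhere $d$-dimensional polyhedron $X$ ($d\ge1$), with associated p.l. map $g$ on $X$. Let $J:{}^dK^*\to{}^dK$ be the inclusion map and $G^*=J^{-1}\circ\gamma$ the associated relation on ${}^dK^*$. Then $$H_\gamma=\{(\mathbf{s}^*,x)\in{}^dK^*_{G^*}\times X: g^i(x)\in s^*_i\text{ for all } i\in\mathbb{Z}_+\}$$ is (the graph of) an almost one-to-one continuous map from ${}^dK^*_{G^*}$ onto $X$ which satisfies $H_\gamma\circ S=g\circ H_\gamma$.
   Context: Simplicial complexes, subdivisions, proper subdivisions (no simplex of $K^*$ meets two disjoint simplices of $K$), simplicial maps and associated p.l. maps $g(x)=\sum_vb_v(x)\gamma(v)$ are as usual. A simplicial dynamical system is a simplicial map $\gamma:K^*\to K$ with $K^*$ a proper subdivision of $K$; it is non-degenerate if $\dim\gamma(s^* )=\dim s^*$ for every simplex $s^*$ of $K^*$. A polyhedron is everywhere $d$-dimensional if it is a union of $d$-dimensional closed simplices. ${}^dK$ and ${}^dK^*$ denote the sets of $d$-simplices of $K$ and $K^*$; $J(s^* )$ is the unique $d$-simplex of $K$ containing $s^*$, and $\gamma$ restricts to a map ${}^dK^*\to{}^dK$. $(s_1^*,s_2^* )\in G^*$ iff $s_2^*\subset\gamma(s_1^* )$. For a relation $G^*$ on the finite set ${}^dK^*$, ${}^dK^*_{G^*}=\{\mathbf{s}^*\in({}^dK^* )^{\mathbb{Z}_+}:(s^*_i,s^*_{i+1})\in G^*\ \forall i\}$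 with the product topology and shift $S(\mathbf{s}^* )_i=s^*_{i+1}$. A continuous map $h$ is almost one-to-one if $\{y:h^{-1}(h(y))=\{y\}\}$ is dense in the domain. *)

(* Defs.v *)
From Stdlib Require Import Reals List Arith.
Import ListNotations.
Open Scope R_scope.

(* Points of Euclidean space: coordinate functions nat -> R.  A complex
   "in R^n" has all vertex coordinates of index >= n equal to 0. *)
Definition pt := nat -> R.

(* A simplex is given by its (duplicate-free) list of vertices. *)
Definition simplex := list pt.

Definition wsum (b : pt -> R) (s : simplex) : R :=
  fold_right (fun v a => b v + a) 0 s.

Definition lincomb (b : pt -> R) (f : pt -> pt) (s : simplex) : pt :=
  fun j => fold_right (fun v a => b v * f v j + a) 0 s.

Definition aff_indep (s : simplex) : Prop :=
  NoDup s /\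
  forall b : pt -> R, wsum b s = 0 -> (forall j, lincomb b (fun v => v) s j = 0) ->
    forall v, In v s -> b v = 0.

Definition bary (s : simplex) (b : pt -> R) (x : pt) : Prop :=
  (forall v, In v s -> 0 <= b v) /\ wsum b s = 1 /\
  (forall j, x j = lincomb b (fun v => v) s j).

Definition csimp (s : simplex) (x : pt) : Prop := exists b, bary s b x.

Definition same_set (s t : simplex) : Prop := forall v, In v s <-> In v t.

(* A finite geometric simplicial complex in R^n, each simplex represented by a
   unique vertex list. *)
Definition sc_complex (n : nat) (K : list simplex) : Prop :=
  (forall s, In s K -> s <> [] /\ aff_indep s /\
     forall v, In v s -> forall j, (n <= j)%nat -> v j = 0) /\
  (forall s t, In s K -> In t K -> same_set s t -> s = t) /\
  (forall s t, In s K -> t <> [] -> incl t s -> exists u, In u K /\ same_set u t) /\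
  (forall s t, In s K -> In t K -> (exists x, csimp s x /\ csimp t x) ->
     exists u, In u K /\ incl u s /\ incl u t /\
       forall x, (csimp s x /\ csimp t x) <-> csimp u x).

Definition polyh (K : list simplex) (x : pt) : Prop :=
  exists s, In s K /\ csimp s x.

Definition everywhere_dim (d : nat) (K : list simplex) : Prop :=
  exists L : list simplex,
    (forall s, In s L -> aff_indep s /\ length s = S d) /\
    forall x, polyh K x <-> exists s, In s L /\ csimp s x.

Definition pl_subdivision (n : nat) (Ks K : list simplex) : Prop :=
  sc_complex n Ks /\
  (forall s, In s Ks -> exists t, In t K /\ forall x, csimp s x -> csimp t x) /\
  (forall x, polyh Ks x <-> polyh K x).

Definition proper_sub (Ks K : list simplex) : Prop :=
  forall s t u, In s Ks -> In t K -> In u K ->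
    (forall x, ~ (csimp t x /\ csimp u x)) ->
    ~ ((exists x, csimp s x /\ csimp t x) /\ (exists y, csimp s y /\ csimp u y)).

(* gam (a vertex map) is a simplicial map K* -> K; the simplex gamma(s)
   is the t in K with vertex set gam(vertices of s) *)
Definition simplicial_map (Ks K : list simplex) (gam : pt -> pt) : Prop :=
  forall s, In s Ks -> exists t, In t K /\ same_set t (map gam s).

Definition nondegenerate (Ks K : list simplex) (gam : pt -> pt) : Prop :=
  forall s t, In s Ks -> In t K -> same_set t (map gam s) -> length t = length s.

Definition assoc_pl (Ks : list simplex) (gam g : pt -> pt) : Prop :=
  forall s b x, In s Ks -> bary s b x -> forall j, g x j = lincomb b gam s j.

Definition Gstar (K : list simplex) (gam : pt -> pt) (s1 s2 : simplex) : Prop :=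
  exists t, In t K /\ same_set t (map gam s1) /\ forall x, csimp s2 x -> csimp t x.

Definition Sigma (d : nat) (Ks K : list simplex) (gam : pt -> pt)
  (sq : nat -> simplex) : Prop :=
  forall i, In (sq i) Ks /\ length (sq i) = S d /\ Gstar K gam (sq i) (sq (S i)).

Definition shift (sq : nat -> simplex) : nat -> simplex := fun i => sq (S i).

Definition Hgam (K : list simplex) (g : pt -> pt) (sq : nat -> simplex) (x : pt) : Prop :=
  polyh K x /\ forall i, csimp (sq i) (Nat.iter i g x).

(* agreement on the first m coordinates (cylinder sets of the product topology) *)
Definition agree (m : nat) (sq tq : nat -> simplex) : Prop :=
  forall i, (i < m)%nat -> sq i = tq i.

Definition edist (n : nat) (x y : pt) : R :=
  fold_right (fun j a => Rabs (x j - y j) + a) 0 (seq 0 n).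

(* Main.v *)
(* Since a simplex of Ks never meets two disjoint simplices of K, any two vertices of a simplex s'
   contained in a simplex t of K have barycentric coordinates in t that are both at least
   some uniform kappa > 0 at a common vertex of t. Hence a function affine on t oscillates on s' at
   most (1 - kappa) times as much as on t. As gamma is non-degenerate, g maps s' affinely and
   bijectively onto gamma(s'), so pushing an affine function forward along g and restricting it
   to the next simplex again and again shows that two points sharing an itinerary up to time m
   are (1 - kappa)^m-close. Existence, uniqueness and continuity of the coded point follow.

   Surjectivity needs that each d-simplex t of K is the union of the d-simplices of Ks in t: a
   curve leaving a point of t in a generic direction avoids, for small times, all
   simplices of dimension less than d.

   A point whose whole orbit stays in open d-simplices of Ks has exactly one itinerary. Images
   of points outside the open d-simplices stay outside, so it is enough that the orbit returns to open
   simplices infinitely often; this is arranged by inserting into the itinerary, again and again, long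
   initial words of itineraries of barycenters. *)
Require Import Defs.
From Stdlib Require Import Reals List Arith Lra Lia Permutation.
From Stdlib Require Import Classical ClassicalEpsilon FunctionalExtensionality.
Import ListNotations.
Open Scope R_scope.

(** * Finite sums over vertex lists *)

Lemma wsum_ext (a b : pt -> R) (s : simplex) :
  (forall v, In v s -> a v = b v) -> wsum a s = wsum b s.
Proof.
  induction s as [|u s IH]; simpl; intros H; [reflexivity|].
  rewrite (H u), IH; auto.
Qed.

Lemma wsum_plus (a b : pt -> R) (s : simplex) :
  wsum (fun v => a v + b v) s = wsum a s + wsum b s.
Proof. induction s as [|u s IH]; simpl; [ring|]. rewrite IH; ring. Qed.

Lemma wsum_scal (c : R) (a : pt -> R) (s : simplex) :
  wsum (fun v => c * a v) s = c * wsum a s.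
Proof. induction s as [|u s IH]; simpl; [ring|]. rewrite IH; ring. Qed.

Lemma wsum_minus (a b : pt -> R) (s : simplex) :
  wsum (fun v => a v - b v) s = wsum a s - wsum b s.
Proof. induction s as [|u s IH]; simpl; [ring|]. rewrite IH; ring. Qed.

Lemma wsum_const (c : R) (s : simplex) :
  wsum (fun _ => c) s = INR (length s) * c.
Proof.
  induction s as [|u s IH]; [simpl; ring|].
  change (length (u :: s)) with (S (length s)). rewrite S_INR; simpl. rewrite IH; ring.
Qed.

Lemma wsum_zero (a : pt -> R) (s : simplex) :
  (forall v, In v s -> a v = 0) -> wsum a s = 0.
Proof.
  intros H. rewrite (wsum_ext a (fun _ => 0) s H), wsum_const; ring.
Qed.

Lemma wsum_le (a b : pt -> R) (s : simplex) :
  (forall v, In v s -> a v <= b v) -> wsum a s <= wsum b s.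
Proof.
  induction s as [|u s IH]; simpl; intros H; [lra|].
  apply Rplus_le_compat; auto.
Qed.

Lemma wsum_nonneg (a : pt -> R) (s : simplex) :
  (forall v, In v s -> 0 <= a v) -> 0 <= wsum a s.
Proof.
  intros H. rewrite <- (wsum_zero (fun _ => 0) s); auto. apply wsum_le; auto.
Qed.

Lemma wsum_term_le (a : pt -> R) (s : simplex) (v : pt) :
  (forall u, In u s -> 0 <= a u) -> In v s -> a v <= wsum a s.
Proof.
  induction s as [|u s IH]; simpl; [intros _ []|]; intros H [<-|Hv].
  - assert (0 <= wsum a s) by (apply wsum_nonneg; auto). lra.
  - assert (0 <= a u) by auto. assert (a v <= wsum a s) by auto. lra.
Qed.

Lemma wsum_perm (a : pt -> R) (s t : simplex) :
  Permutation s t -> wsum a s = wsum a t.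
Proof.
  induction 1; simpl; try lra.
Qed.

Lemma wsum_map (a : pt -> R) (f : pt -> pt) (s : simplex) :
  wsum a (map f s) = wsum (fun v => a (f v)) s.
Proof. induction s as [|u s IH]; simpl; [reflexivity|]. rewrite IH; ring. Qed.

Lemma wsum_swap (F : pt -> pt -> R) (s t : simplex) :
  wsum (fun v => wsum (fun w => F v w) t) s =
  wsum (fun w => wsum (fun v => F v w) s) t.
Proof.
  induction s as [|u s IH]; simpl.
  - rewrite wsum_zero; auto.
  - rewrite IH, wsum_plus; reflexivity.
Qed.

(** Points are real-valued functions, so their equality can only be decided classically. *)
Definition peq (v w : pt) : {v = w} + {v <> w} := excluded_middle_informative (v = w).

Definition delta (v w : pt) : R := if peq v w then 1 else 0.

Lemma delta_same (v : pt) : delta v v = 1.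
Proof. unfold delta. destruct (peq v v); [reflexivity|congruence]. Qed.

Lemma delta_diff (v w : pt) : v <> w -> delta v w = 0.
Proof. unfold delta. destruct (peq v w); [congruence|reflexivity]. Qed.

Lemma delta_nonneg (v w : pt) : 0 <= delta v w.
Proof. unfold delta. destruct (peq v w); lra. Qed.

Lemma wsum_delta (F : pt -> R) (s : simplex) (v : pt) :
  NoDup s -> In v s -> wsum (fun w => delta v w * F w) s = F v.
Proof.
  induction s as [|u s IH]; simpl; [intros _ []|]; intros Hd [->|Hv]; inversion Hd; subst.
  - rewrite delta_same, wsum_zero; [ring|].
    intros w Hw. rewrite delta_diff; [ring|]. intros <-; auto.
  - rewrite IH, delta_diff; auto; [ring|]. intros ->; auto.
Qed.

Lemma wsum_filter (P : pt -> bool) (a : pt -> R) (s : simplex) :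
  (forall v, In v s -> P v = false -> a v = 0) -> wsum a s = wsum a (filter P s).
Proof.
  induction s as [|u s IH]; simpl; intros H; [reflexivity|].
  destruct (P u) eqn:E; simpl; rewrite IH; auto. rewrite (H u); auto; ring.
Qed.

Lemma wsum_sub (a : pt -> R) (s u : simplex) :
  NoDup s -> NoDup u -> incl u s ->
  (forall v, In v s -> ~ In v u -> a v = 0) -> wsum a s = wsum a u.
Proof.
  intros Hs Hu Hus H.
  set (P := fun v => if in_dec peq v u then true else false).
  rewrite (wsum_filter P).
  - apply wsum_perm, NoDup_Permutation; auto using NoDup_filter.
    intros v. rewrite filter_In. unfold P. specialize (Hus v).
    destruct (in_dec peq v u); intuition congruence.
  - intros v Hv. unfold P. destruct (in_dec peq v u); [discriminate|auto].
Qed.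

Lemma in_perm_cons (v : pt) (s : simplex) :
  In v s -> exists s', Permutation s (v :: s').
Proof.
  intros H. apply in_split in H as (s1 & s2 & ->).
  exists (s1 ++ s2). symmetry. apply Permutation_middle.
Qed.

(** * Linear dependence and barycentric coordinates *)

(** Gaussian elimination on the matrix [M], with rows indexed by [s] and columns by [t]: a row [v0]
    with nonzero entry in column [w] is used as pivot to clear that column, and induction handles
    the remaining columns. *)
Lemma linear_dependence (t : simplex) : forall (s : simplex) (M : pt -> pt -> R),
  NoDup s -> (length t < length s)%nat ->
  exists b : pt -> R, (exists v, In v s /\ b v <> 0) /\
    forall w, In w t -> wsum (fun v => b v * M v w) s = 0.
Proof.
  induction t as [|w t IH]; intros s M Hs Hl.
  - exists (fun _ => 1). split; [|intros w []].
    destruct s as [|v s]; simpl in Hl; [lia|]. exists v. split; [left; auto|lra].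
  - simpl in Hl.
    destruct (classic (exists v0, In v0 s /\ M v0 w <> 0)) as [(v0 & H0 & HM)|Hz].
    + destruct (in_perm_cons v0 s H0) as (s' & Hp).
      assert (Hnd : NoDup (v0 :: s')) by (eapply Permutation_NoDup; eauto).
      inversion Hnd as [|? ? Hn Hs']; subst.
      pose proof (Permutation_length Hp) as Hlen; simpl in Hlen.
      destruct (IH s' (fun v w' => M v w' - M v w / M v0 w * M v0 w')) as (b & (v & Hv & Hb) & Hsum);
        [auto|lia|].
      (* The pivot row collects all the multiples subtracted from the other rows. *)
      set (b0 := - wsum (fun v => b v * (M v w / M v0 w)) s').
      exists (fun u => if peq u v0 then b0 else b u). split.
      * exists v. split.
        -- eapply Permutation_in; [symmetry; exact Hp|right; auto].
        -- destruct (peq v v0); [congruence|auto].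
      * assert (E : forall w', wsum (fun u => (if peq u v0 then b0 else b u) * M u w') s =
                      b0 * M v0 w' + wsum (fun u => b u * M u w') s').
        { intros w'. rewrite (wsum_perm _ _ _ Hp). simpl.
          destruct (peq v0 v0); [|congruence]. f_equal.
          apply wsum_ext. intros u Hu. destruct (peq u v0); [congruence|auto]. }
        assert (E' : forall w', wsum (fun u => (if peq u v0 then b0 else b u) * M u w') s =
                      wsum (fun u => b u * (M u w' - M u w / M v0 w * M v0 w')) s').
        { intros w'. rewrite E. unfold b0.
          rewrite (wsum_ext (fun u => b u * (M u w' - M u w / M v0 w * M v0 w'))
                    (fun u => b u * M u w' - M v0 w' * (b u * (M u w / M v0 w))))
            by (intros; ring).
          rewrite wsum_minus, wsum_scal. ring. }
        intros w' [<-|Hw'].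
        -- rewrite E'. apply wsum_zero. intros u _. field; auto.
        -- rewrite E'. auto.
    + destruct (IH s M) as (b & Hb & Hsum); [auto|lia|].
      exists b. split; auto. intros w' [<-|Hw']; auto.
      apply wsum_zero. intros v Hv.
      destruct (Req_dec (M v w) 0) as [->|]; [ring|]. exfalso; eauto.
Qed.

Lemma lincomb_eq (b : pt -> R) (f : pt -> pt) (s : simplex) (j : nat) :
  lincomb b f s j = wsum (fun v => b v * f v j) s.
Proof. reflexivity. Qed.

Lemma combine_wsum (p F : pt -> R) (B : pt -> pt -> R) (s t : simplex) :
  wsum (fun w => wsum (fun v => p v * B v w) s * F w) t =
  wsum (fun v => p v * wsum (fun w => B v w * F w) t) s.
Proof.
  transitivity (wsum (fun w => wsum (fun v => p v * B v w * F w) s) t).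
  - apply wsum_ext. intros w _.
    rewrite (Rmult_comm _ (F w)), <- wsum_scal. apply wsum_ext; intros; ring.
  - rewrite wsum_swap. apply wsum_ext. intros v _.
    rewrite <- wsum_scal. apply wsum_ext; intros; ring.
Qed.

Lemma combine_wsum1 (p : pt -> R) (B : pt -> pt -> R) (s t : simplex) :
  wsum (fun w => wsum (fun v => p v * B v w) s) t =
  wsum (fun v => p v * wsum (B v) t) s.
Proof.
  rewrite wsum_swap. apply wsum_ext. intros v _. apply wsum_scal.
Qed.

(** With more points than weights the weight rows [B v] are linearly dependent. As each row sums to
    1 and reproduces [v], this is an affine dependence of [s]. The weights may be negative, so the
    bound covers affine hulls as well as simplices. *)
Lemma rank_le (s t : simplex) (B : pt -> pt -> R) :
  aff_indep s ->
  (forall v, In v s -> wsum (B v) t = 1 /\ forall j, v j = lincomb (B v) (fun w => w) t j) ->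
  (length s <= length t)%nat.
Proof.
  intros [Hnd Hind] H. apply Nat.nlt_ge. intros Hlt.
  destruct (linear_dependence t s B Hnd Hlt) as (b & (v & Hv & Hb) & Hsum).
  apply Hb, Hind; auto.
  - transitivity (wsum (fun v => b v * wsum (B v) t) s).
    + apply wsum_ext. intros u Hu. rewrite (proj1 (H u Hu)); ring.
    + rewrite <- combine_wsum1. apply wsum_zero; auto.
  - intros j. rewrite lincomb_eq.
    transitivity (wsum (fun v => b v * wsum (fun w => B v w * w j) t) s).
    + apply wsum_ext. intros u Hu. rewrite (proj2 (H u Hu) j) at 1. reflexivity.
    + rewrite <- combine_wsum. apply wsum_zero. intros w Hw. rewrite Hsum; auto; ring.
Qed.

Lemma bary_unique (s : simplex) (b c : pt -> R) (x : pt) :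
  aff_indep s -> bary s b x -> bary s c x -> forall v, In v s -> b v = c v.
Proof.
  intros [_ Hind] (_ & Hb & Hbx) (_ & Hc & Hcx) v Hv.
  enough (b v - c v = 0) by lra.
  apply (Hind (fun v => b v - c v)); auto.
  - rewrite wsum_minus; lra.
  - intros j. rewrite lincomb_eq.
    rewrite (wsum_ext _ (fun v => b v * v j - c v * v j)) by (intros; ring).
    rewrite wsum_minus. rewrite <- !(lincomb_eq _ (fun v => v)), <- Hbx, <- Hcx. ring.
Qed.

Lemma bary_vertex (s : simplex) (v : pt) :
  NoDup s -> In v s -> bary s (delta v) v.
Proof.
  intros Hs Hv. split; [|split].
  - intros; apply delta_nonneg.
  - rewrite <- (wsum_delta (fun _ => 1) s v) by auto. apply wsum_ext; intros; ring.
  - intros j. rewrite lincomb_eq, (wsum_delta (fun w => w j)); auto.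
Qed.

Lemma csimp_vertex (s : simplex) (v : pt) : NoDup s -> In v s -> csimp s v.
Proof. intros; exists (delta v); apply bary_vertex; auto. Qed.

(** Barycentric coordinates compose like stochastic matrices. *)
Lemma bary_comp (s t : simplex) (p : pt -> R) (B : pt -> pt -> R) (x : pt) :
  bary s p x -> (forall v, In v s -> bary t (B v) v) ->
  bary t (fun w => wsum (fun v => p v * B v w) s) x.
Proof.
  intros (H0 & H1 & H2) HB. split; [|split].
  - intros w Hw. apply wsum_nonneg. intros v Hv.
    apply Rmult_le_pos; [auto|apply (HB v Hv); auto].
  - rewrite combine_wsum1, <- H1. apply wsum_ext. intros v Hv.
    destruct (HB v Hv) as (_ & -> & _); ring.
  - intros j. rewrite H2, !lincomb_eq, combine_wsum. apply wsum_ext. intros v Hv.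
    destruct (HB v Hv) as (_ & _ & E). rewrite (E j) at 1. reflexivity.
Qed.

Lemma csimp_comp (s t : simplex) :
  (forall v, In v s -> csimp t v) -> forall x, csimp s x -> csimp t x.
Proof.
  intros H x (p & Hp).
  set (B := fun v => epsilon (inhabits (fun _ : pt => 0)) (fun b => bary t b v)).
  exists (fun w => wsum (fun v => p v * B v w) s). apply bary_comp; auto.
  intros v Hv. unfold B. apply epsilon_spec, H; auto.
Qed.

Lemma bary_incl (u s : simplex) (b : pt -> R) (x : pt) :
  NoDup s -> incl u s -> bary u b x ->
  exists c, bary s c x /\ forall v, ~ In v u -> c v = 0.
Proof.
  intros Hs Hus Hb. exists (fun w => wsum (fun v => b v * delta v w) u). split.
  - apply bary_comp; auto. intros v Hv. apply bary_vertex; auto.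
  - intros v Hv. apply wsum_zero. intros w Hw. rewrite delta_diff; [ring|].
    intros ->; auto.
Qed.

Lemma csimp_incl (u s : simplex) (x : pt) :
  NoDup s -> incl u s -> csimp u x -> csimp s x.
Proof.
  intros Hs Hus (b & Hb). destruct (bary_incl u s b x) as (c & Hc & _); auto.
  exists c; auto.
Qed.

Lemma bary_sub (u s : simplex) (b : pt -> R) (x : pt) :
  NoDup s -> NoDup u -> incl u s -> (forall v, In v s -> ~ In v u -> b v = 0) ->
  bary s b x -> bary u b x.
Proof.
  intros Hs Hu Hus Hz (H0 & H1 & H2). split; [|split]; auto.
  - rewrite <- H1. symmetry; apply wsum_sub; auto.
  - intros j. rewrite H2. apply wsum_sub; auto.
    intros v Hv Hn. rewrite (Hz v Hv Hn); ring.
Qed.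

Lemma bary_nonempty (s : simplex) (b : pt -> R) (x : pt) :
  bary s b x -> exists v, In v s /\ 0 < b v.
Proof.
  intros (H0 & H1 & _). apply NNPP. intros Hn.
  enough (wsum b s = 0) by lra.
  apply wsum_zero. intros v Hv. destruct (H0 v Hv); auto. exfalso; eauto.
Qed.

(** * Affine functions and covers of a simplex by simplices *)

(** Arbitrary coefficients are allowed: the term at the origin brings the total weight to 1. Such
    functions live on the whole space, not only on a simplex. *)
Definition affine (f : pt -> R) : Prop :=
  forall a b x y, f (fun j => a * x j + b * y j) =
    a * f x + b * f y + (1 - a - b) * f (fun _ => 0).

Lemma affine_lincomb (f : pt -> R) (b : pt -> R) (s : simplex) :
  affine f ->
  f (lincomb b (fun v => v) s) =
  wsum (fun v => b v * f v) s + (1 - wsum b s) * f (fun _ => 0).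
Proof.
  intros Hf. induction s as [|u s IH].
  - simpl. unfold lincomb; simpl. ring.
  - replace (lincomb b (fun v => v) (u :: s)) with
      (fun j => b u * u j + 1 * lincomb b (fun v => v) s j)
      by (apply functional_extensionality; intros j; unfold lincomb; simpl; ring).
    rewrite Hf, IH. simpl. ring.
Qed.

Lemma affine_bary (f : pt -> R) (s : simplex) (b : pt -> R) (x : pt) :
  affine f -> bary s b x -> f x = wsum (fun v => b v * f v) s.
Proof.
  intros Hf (_ & H1 & H2).
  replace x with (lincomb b (fun v => v) s)
    by (apply functional_extensionality; intros j; auto).
  rewrite affine_lincomb, H1 by auto. ring.
Qed.

Lemma affine_const (c : R) : affine (fun _ => c).
Proof. intros a b x y. ring. Qed.

Lemma affine_coord (j : nat) : affine (fun x => x j).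
Proof. intros a b x y. ring. Qed.

Lemma affine_minus (f g : pt -> R) : affine f -> affine g -> affine (fun x => f x - g x).
Proof. intros Hf Hg a b x y. rewrite Hf, Hg. ring. Qed.

Lemma affine_scal (c : R) (f : pt -> R) : affine f -> affine (fun x => c * f x).
Proof. intros Hf a b x y. rewrite Hf. ring. Qed.

Lemma affine_wsum (F : pt -> pt -> R) (s : simplex) :
  (forall v, In v s -> affine (F v)) -> affine (fun x => wsum (fun v => F v x) s).
Proof.
  intros H a b x y. induction s as [|u s IH]; simpl; [ring|].
  rewrite IH, (H u (or_introl eq_refl)) by (intros; apply H; right; auto). ring.
Qed.

(** Affine extensions of the barycentric coordinates of [s] to the whole space. *)
Definition dual_basis (s : simplex) (phi : pt -> pt -> R) : Prop :=
  forall v, In v s -> affine (phi v) /\ forall u, In u s -> phi v u = delta v u.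

(** This and [coord_defect] are, for a dual basis, affine equations of the affine hull of [s]: all
    vanish at [x] exactly when the numbers [phi v x] are weights of total 1 reproducing [x]. *)
Definition mass_defect (phi : pt -> pt -> R) (s : simplex) (x : pt) : R :=
  1 - wsum (fun v => phi v x) s.

Definition coord_defect (phi : pt -> pt -> R) (s : simplex) (j : nat) (x : pt) : R :=
  x j - wsum (fun v => v j * phi v x) s.

Lemma affine_mass_defect (s : simplex) (phi : pt -> pt -> R) :
  dual_basis s phi -> affine (mass_defect phi s).
Proof.
  intros H. apply affine_minus; [apply affine_const|].
  apply affine_wsum. intros v Hv. apply (H v Hv).
Qed.

Lemma affine_coord_defect (s : simplex) (phi : pt -> pt -> R) (j : nat) :
  dual_basis s phi -> affine (coord_defect phi s j).
Proof.
  intros H. apply affine_minus; [apply affine_coord|].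
  apply (affine_wsum (fun v x => v j * phi v x)). intros v Hv.
  apply affine_scal, (H v Hv).
Qed.

Lemma mass_defect_vertex (s : simplex) (phi : pt -> pt -> R) (u : pt) :
  NoDup s -> dual_basis s phi -> In u s -> mass_defect phi s u = 0.
Proof.
  intros Hs H Hu. unfold mass_defect.
  rewrite (wsum_ext _ (fun v => delta u v * 1)).
  - rewrite (wsum_delta (fun _ => 1)); auto; ring.
  - intros v Hv. rewrite (proj2 (H v Hv) u Hu).
    unfold delta. destruct (peq v u), (peq u v); try congruence; ring.
Qed.

Lemma coord_defect_vertex (s : simplex) (phi : pt -> pt -> R) (j : nat) (u : pt) :
  NoDup s -> dual_basis s phi -> In u s -> coord_defect phi s j u = 0.
Proof.
  intros Hs H Hu. unfold coord_defect.
  rewrite (wsum_ext _ (fun v => delta u v * v j)).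
  - rewrite (wsum_delta (fun v => v j)); auto; ring.
  - intros v Hv. rewrite (proj2 (H v Hv) u Hu).
    unfold delta. destruct (peq v u), (peq u v); try congruence; ring.
Qed.

Lemma aff_indep_tail (u : pt) (s : simplex) : aff_indep (u :: s) -> aff_indep s.
Proof.
  intros [Hnd H]. inversion Hnd as [|? ? Hu Hs]; subst. split; auto.
  intros b Hb1 Hb2 v Hv.
  set (c := fun w => if peq w u then 0 else b w).
  assert (E : forall w, In w s -> c w = b w)
    by (intros w Hw; unfold c; destruct (peq w u); [congruence|auto]).
  assert (Ec : c u = 0) by (unfold c; destruct (peq u u); congruence).
  rewrite <- E by auto. apply H; [| |right; auto].
  - simpl. rewrite Ec, (wsum_ext c b), Hb1 by auto. ring.
  - intros j. rewrite lincomb_eq. simpl.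
    rewrite Ec, (wsum_ext _ (fun w => b w * w j)) by (intros; rewrite E; auto).
    rewrite <- (lincomb_eq b (fun v => v)), Hb2. ring.
Qed.

(** Induction on the vertices. The new vertex [u] is off the affine hull of the old ones, so some
    defect [rho] is nonzero at [u]; rescaled it serves [u], and subtracting multiples of it makes
    the old functions vanish at [u]. *)
Lemma dual_basis_exists (s : simplex) : aff_indep s -> exists phi, dual_basis s phi.
Proof.
  induction s as [|u s IH]; intros Hs.
  - exists (fun _ _ => 0). intros v [].
  - destruct (IH (aff_indep_tail u s Hs)) as (phi & Hphi).
    destruct Hs as [Hnd Hind]. inversion Hnd as [|? ? Hu Hs']; subst.
    assert (Hrho : exists rho, affine rho /\ (forall v, In v s -> rho v = 0) /\ rho u <> 0).
    { destruct (Req_dec (mass_defect phi s u) 0) as [H0|H0].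
      2:{ exists (mass_defect phi s). split; [apply affine_mass_defect; auto|].
          split; auto. intros; apply mass_defect_vertex; auto. }
      destruct (classic (exists j, coord_defect phi s j u <> 0)) as [(j & Hj)|Hn].
      { exists (coord_defect phi s j). split; [apply affine_coord_defect; auto|].
        split; auto. intros; apply coord_defect_vertex; auto. }
      exfalso.
      (* If all defects vanish at [u], then [u] is an affine combination of [s], which gives this
         forbidden dependence. *)
      set (b := fun w => if peq w u then -1 else phi w u).
      assert (Eu : b u = -1) by (unfold b; destruct (peq u u); congruence).
      assert (E : forall w, In w s -> b w = phi w u)
        by (intros w Hw; unfold b; destruct (peq w u); [congruence|auto]).
      enough (b u = 0) by lra.
      apply Hind; [| |left; auto].
      - simpl. rewrite (wsum_ext b (fun w => phi w u)) by auto.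
        unfold mass_defect in H0. lra.
      - intros j. rewrite lincomb_eq. simpl.
        rewrite (wsum_ext _ (fun w => w j * phi w u)) by (intros; rewrite E; auto; ring).
        destruct (Req_dec (coord_defect phi s j u) 0) as [Hj|Hj]; [|exfalso; eauto].
        unfold coord_defect in Hj. rewrite Eu. lra. }
    destruct Hrho as (rho & Hra & Hr0 & Hru).
    exists (fun v x => if peq v u then / rho u * rho x
                       else phi v x - phi v u * (/ rho u * rho x)).
    intros v Hv. destruct (peq v u) as [->|Hvu].
    + split; [apply affine_scal; auto|].
      intros w [<-|Hw].
      * rewrite delta_same. field; auto.
      * rewrite (Hr0 w Hw), delta_diff by congruence. ring.
    + destruct Hv as [->|Hv]; [congruence|]. destruct (Hphi v Hv) as [Ha Hd]. split.
      * apply affine_minus; auto. apply affine_scal, affine_scal; auto.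
      * intros w [<-|Hw].
        -- rewrite delta_diff by auto. field; auto.
        -- rewrite (Hr0 w Hw), Hd by auto. ring.
Qed.

Lemma dual_basis_bary (s : simplex) (phi : pt -> pt -> R) (b : pt -> R) (x v : pt) :
  NoDup s -> dual_basis s phi -> bary s b x -> In v s -> phi v x = b v.
Proof.
  intros Hs H Hb Hv. destruct (H v Hv) as [Ha Hd].
  rewrite (affine_bary _ s b x Ha Hb).
  rewrite (wsum_ext _ (fun w => delta v w * b w)).
  - apply wsum_delta; auto.
  - intros w Hw. rewrite Hd; auto; ring.
Qed.

Lemma affine_zero_csimp (f : pt -> R) (s : simplex) (x : pt) :
  affine f -> (forall v, In v s -> f v = 0) -> csimp s x -> f x = 0.
Proof.
  intros Hf H0 (b & Hb). rewrite (affine_bary f s b x Hf Hb).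
  apply wsum_zero. intros v Hv. rewrite H0; auto; ring.
Qed.

Lemma csimp_of_dual (s : simplex) (phi : pt -> pt -> R) (x : pt) :
  (forall v, In v s -> 0 <= phi v x) -> mass_defect phi s x = 0 ->
  (forall j, coord_defect phi s j x = 0) -> csimp s x.
Proof.
  unfold mass_defect, coord_defect. intros H0 H1 H2.
  exists (fun v => phi v x). split; [|split]; auto; [lra|].
  intros j. rewrite lincomb_eq.
  rewrite (wsum_ext _ (fun v => v j * phi v x)) by (intros; ring).
  specialize (H2 j). lra.
Qed.

(** * Curves in generic directions, at small times *)

Definition small (P : R -> Prop) : Prop :=
  exists e, 0 < e /\ forall t, 0 < t < e -> P t.

Lemma small_all {A : Type} (F : list A) (P : A -> R -> Prop) :
  (forall c, In c F -> small (P c)) -> small (fun t => forall c, In c F -> P c t).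
Proof.
  induction F as [|c F IH]; intros H.
  - exists 1. split; [lra|]. intros t _ c [].
  - destruct (H c (or_introl eq_refl)) as (e1 & He1 & H1).
    destruct IH as (e2 & He2 & H2); [intros; apply H; right; auto|].
    exists (Rmin e1 e2). split; [apply Rmin_glb_lt; auto|].
    intros t Ht c' Hc'. pose proof (Rmin_l e1 e2). pose proof (Rmin_r e1 e2).
    destruct Hc' as [<-|Hc']; [apply H1; lra|apply H2; auto; lra].
Qed.

Lemma small_witness (P : R -> Prop) : small P -> exists t, 0 < t < 1 /\ P t.
Proof.
  intros (e & He & H). exists (Rmin e 1 / 2).
  pose proof (Rmin_l e 1). pose proof (Rmin_r e 1).
  assert (0 < Rmin e 1) by (apply Rmin_glb_lt; lra).
  split; [lra|]. apply H; lra.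
Qed.

(* A curve starting at [x] at time 0, which leaves every proper affine subspace of the span of [l]:
   an affine [f] takes the value (1-t) f(x) + t ((1-t) f(w_0) + t ((1-t) f(w_1) + ...)), so
   its sign for small t is that of the first nonzero one among f(x), f(w_0), f(w_1), ... *)
Fixpoint curve (t : R) (x : pt) (l : simplex) : pt :=
  match l with
  | [] => x
  | w :: l' => fun j => (1 - t) * x j + t * curve t w l' j
  end.

Lemma curve_affine (f : pt -> R) (t : R) (x w : pt) (l : simplex) :
  affine f -> f (curve t x (w :: l)) = (1 - t) * f x + t * f (curve t w l).
Proof. intros Hf. simpl. rewrite Hf. ring. Qed.

Lemma curve_bounded (f : pt -> R) (l : simplex) :
  affine f -> forall x, exists C, 0 <= C /\ forall t, 0 < t < 1 -> Rabs (f (curve t x l)) <= C.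
Proof.
  intros Hf. induction l as [|w l IH]; intros x.
  - exists (Rabs (f x)). split; [apply Rabs_pos|]. intros; simpl; lra.
  - destruct (IH w) as (C & HC & H). exists (Rabs (f x) + C).
    split; [pose proof (Rabs_pos (f x)); lra|].
    intros t Ht. rewrite curve_affine by auto.
    eapply Rle_trans; [apply Rabs_triang|].
    rewrite !Rabs_mult, (Rabs_right (1 - t)), (Rabs_right t) by lra.
    specialize (H t Ht). pose proof (Rabs_pos (f x)).
    pose proof (Rabs_pos (f (curve t w l))). nra.
Qed.

Lemma curve_neg (f : pt -> R) (x : pt) (l : simplex) :
  affine f -> f x < 0 -> small (fun t => f (curve t x l) < 0).
Proof.
  intros Hf Hx. destruct l as [|w l].
  - exists 1. split; [lra|]. intros; simpl; auto.
  - destruct (curve_bounded f l Hf w) as (C & HC & H).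
    (* The time at which the upper bound [(1 - t) * f x + t * C] reaches zero. *)
    assert (Hq : 0 < - f x / (C - f x)) by (apply Rdiv_lt_0_compat; lra).
    exists (Rmin 1 (- f x / (C - f x))). split; [apply Rmin_glb_lt; lra|].
    intros t Ht. pose proof (Rmin_l 1 (- f x / (C - f x))).
    pose proof (Rmin_r 1 (- f x / (C - f x))).
    rewrite curve_affine by auto.
    assert (Ht1 : 0 < t < 1) by lra. specialize (H t Ht1).
    pose proof (Rle_abs (f (curve t w l))).
    assert (t * (C - f x) < - f x).
    { apply Rlt_le_trans with (- f x / (C - f x) * (C - f x)).
      - apply Rmult_lt_compat_r; lra.
      - right. field. lra. }
    nra.
Qed.

Lemma curve_nonzero (f : pt -> R) (l : simplex) :
  affine f -> forall x, (exists w, In w (x :: l) /\ f w <> 0) ->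
  small (fun t => f (curve t x l) <> 0).
Proof.
  intros Hf. induction l as [|w l IH]; intros x Hw.
  - destruct Hw as (w & [<-|[]] & H). exists 1. split; [lra|]. intros; simpl; auto.
  - destruct (Rtotal_order (f x) 0) as [Hx|[Hx|Hx]].
    + destruct (curve_neg f x (w :: l) Hf Hx) as (e & He & H).
      exists e. split; auto. intros t Ht. specialize (H t Ht); lra.
    + destruct (IH w) as (e & He & H).
      { destruct Hw as (w' & [<-|Hw] & H); [congruence|eauto]. }
      exists e. split; auto. intros t Ht. rewrite curve_affine, Hx by auto.
      specialize (H t Ht). rewrite Rmult_0_r, Rplus_0_l.
      apply Rmult_integral_contrapositive_currified; lra.
    + destruct (curve_neg (fun y => -1 * f y) x (w :: l)) as (e & He & H);
        [apply affine_scal; auto|lra|].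
      exists e. split; auto. intros t Ht. specialize (H t Ht). lra.
Qed.

Lemma csimp_convex (s : simplex) (t : R) (x y : pt) :
  0 <= t <= 1 -> csimp s x -> csimp s y -> csimp s (fun j => (1 - t) * x j + t * y j).
Proof.
  intros Ht (b & B0 & B1 & B2) (c & C0 & C1 & C2).
  exists (fun v => (1 - t) * b v + t * c v). split; [|split].
  - intros v Hv. specialize (B0 v Hv). specialize (C0 v Hv). nra.
  - rewrite wsum_plus, !wsum_scal, B1, C1. ring.
  - intros j. rewrite B2, C2, !lincomb_eq, <- !wsum_scal, <- wsum_plus.
    apply wsum_ext. intros; ring.
Qed.

Lemma curve_csimp (s : simplex) (t : R) (l : simplex) :
  0 < t < 1 -> forall x, (forall w, In w (x :: l) -> csimp s w) -> csimp s (curve t x l).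
Proof.
  intros Ht. induction l as [|w l IH]; intros x H; simpl.
  - apply H; left; auto.
  - apply csimp_convex; [lra|apply H; left; auto|].
    apply IH. intros w' Hw'. apply H; right; auto.
Qed.

(** A simplex is cut out by affine conditions: zero defects and nonnegative coordinates. The point
    [x] violates one of them, and the violation persists for small times. *)
Lemma curve_leaves_complement (s : simplex) (x : pt) (l : simplex) :
  aff_indep s -> ~ csimp s x -> small (fun t => ~ csimp s (curve t x l)).
Proof.
  intros Hs Hx. destruct (dual_basis_exists s Hs) as (phi & Hphi).
  assert (Hnz : forall f, affine f -> (forall v, In v s -> f v = 0) -> f x <> 0 ->
            small (fun t => ~ csimp s (curve t x l))).
  { intros f Hf Hf0 Hfx. destruct (curve_nonzero f l Hf x) as (e & He & H).
    { exists x. split; [left|]; auto. }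
    exists e. split; auto. intros t Ht Hc. apply (H t Ht).
    eapply affine_zero_csimp; eauto. }
  pose proof (proj1 Hs) as Hnd.
  destruct (Req_dec (mass_defect phi s x) 0) as [H1|H1].
  2:{ apply (Hnz (mass_defect phi s)); auto using affine_mass_defect.
      intros; apply mass_defect_vertex; auto. }
  destruct (classic (exists j, coord_defect phi s j x <> 0)) as [(j & Hj)|H2].
  { apply (Hnz (coord_defect phi s j)); auto using affine_coord_defect.
    intros; apply coord_defect_vertex; auto. }
  destruct (classic (exists v, In v s /\ phi v x < 0)) as [(v & Hv & Hvx)|H3].
  - destruct (curve_neg (phi v) x l (proj1 (Hphi v Hv)) Hvx) as (e & He & H).
    exists e. split; auto. intros t Ht (b & Hb). specialize (H t Ht).
    rewrite (dual_basis_bary s phi b _ v) in H by auto.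
    pose proof (proj1 Hb v Hv). lra.
  - exfalso. apply Hx, (csimp_of_dual s phi); auto.
    + intros v Hv. apply Rnot_lt_le. intros Hn. eauto.
    + intros j. apply NNPP. intros Hj. eauto.
Qed.

(** If all defects of [s] vanished on [l], then [l] would lie in the affine hull of [s], against
    [rank_le]. A defect that is nonzero at a vertex of [l] is nonzero along the curve for small
    times. *)
Lemma curve_leaves_lower_dim (s : simplex) (x : pt) (l : simplex) :
  aff_indep s -> aff_indep l -> (length s < length l)%nat ->
  small (fun t => ~ csimp s (curve t x l)).
Proof.
  intros Hs Hl Hlen. destruct (dual_basis_exists s Hs) as (phi & Hphi).
  assert (Hnz : forall f w, affine f -> (forall v, In v s -> f v = 0) -> In w l -> f w <> 0 ->
            small (fun t => ~ csimp s (curve t x l))).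
  { intros f w Hf Hf0 Hw Hfw. destruct (curve_nonzero f l Hf x) as (e & He & H).
    { exists w. split; [right|]; auto. }
    exists e. split; auto. intros t Ht Hc. apply (H t Ht).
    eapply affine_zero_csimp; eauto. }
  pose proof (proj1 Hs) as Hnd. apply NNPP. intros Hn.
  enough (length l <= length s)%nat by lia.
  apply (rank_le l s (fun w v => phi v w)); auto. intros w Hw. split.
  - apply NNPP. intros H. apply Hn, (Hnz (mass_defect phi s) w);
      auto using affine_mass_defect.
    + intros; apply mass_defect_vertex; auto.
    + unfold mass_defect. lra.
  - intros j. apply NNPP. intros H. apply Hn, (Hnz (coord_defect phi s j) w);
      auto using affine_coord_defect.
    + intros; apply coord_defect_vertex; auto.
    + unfold coord_defect. intros E. apply H. rewrite lincomb_eq.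
      rewrite (wsum_ext _ (fun v => v j * phi v w)) by (intros; ring). lra.
Qed.

(** The curve from [x] through the vertices of [l] stays in [l], and for small times it avoids each
    member of the finite family that misses [x] or has too few vertices. The member covering a point
    of the curve is therefore of neither kind. *)
Lemma cover_full_dim (F : list simplex) (P : simplex -> Prop) (l : simplex) (x : pt) :
  (forall c, In c F -> aff_indep c) -> aff_indep l ->
  (forall y, csimp l y -> exists c, In c F /\ P c /\ csimp c y) -> csimp l x ->
  exists c, In c F /\ P c /\ csimp c x /\ (length l <= length c)%nat.
Proof.
  intros HF Hl Hcov Hx. apply NNPP. intros Hn.
  destruct (small_witness (fun t => forall c, In c F -> P c -> ~ csimp c (curve t x l)))
    as (t & Ht & H).
  { apply (small_all F (fun c t => P c -> ~ csimp c (curve t x l))). intros c Hc.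
    assert (Hs : P c -> small (fun t => ~ csimp c (curve t x l))).
    { intros HP. destruct (classic (csimp c x)) as [Hcx|Hcx].
      - apply curve_leaves_lower_dim; auto.
        apply Nat.nle_gt. intros Hle. apply Hn. exists c. auto.
      - apply curve_leaves_complement; auto. }
    destruct (classic (P c)) as [HP|HP].
    - destruct (Hs HP) as (e & He & H). exists e; auto.
    - exists 1. split; [lra|]. tauto. }
  destruct (Hcov (curve t x l)) as (c & Hc & HP & Hcx).
  - apply curve_csimp; auto. intros w [<-|Hw]; auto.
    apply csimp_vertex; auto. apply Hl.
  - apply (H c); auto.
Qed.

(** * Simplicial complexes *)

Definition subset (s t : simplex) : Prop := forall x, csimp s x -> csimp t x.

(** The open simplex, that is, the relative interior of [s]. *)
Definition osimp (s : simplex) (x : pt) : Prop :=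
  exists b, bary s b x /\ forall v, In v s -> 0 < b v.

Lemma complex_indep (n : nat) (K : list simplex) (s : simplex) :
  sc_complex n K -> In s K -> aff_indep s.
Proof. intros (H & _) Hs. apply (H s Hs). Qed.

Lemma complex_nodup (n : nat) (K : list simplex) (s : simplex) :
  sc_complex n K -> In s K -> NoDup s.
Proof. intros HK Hs. apply (complex_indep n K s HK Hs). Qed.

(** The face [u] is spanned by the support of [b]; it has [x] in its relative interior. *)
Lemma carrier (n : nat) (K : list simplex) (s : simplex) (b : pt -> R) (x : pt) :
  sc_complex n K -> In s K -> bary s b x ->
  exists u, In u K /\ incl u s /\ bary u b x /\ (forall v, In v u -> 0 < b v) /\
    forall v, In v s -> ~ In v u -> b v = 0.
Proof.
  intros HK Hs Hb.
  set (P := fun v => if Rlt_dec 0 (b v) then true else false).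
  assert (HP : forall v, P v = true <-> 0 < b v)
    by (intros v; unfold P; destruct (Rlt_dec 0 (b v)); split; congruence).
  destruct HK as (H1 & H2 & H3 & H4).
  destruct (H3 s (filter P s) Hs) as (u & Hu & Hsame).
  { destruct (bary_nonempty s b x Hb) as (v & Hv & Hv0).
    assert (In v (filter P s)) by (apply filter_In; split; auto; apply HP; auto).
    destruct (filter P s); [contradiction|discriminate]. }
  { intros v Hv. apply filter_In in Hv. tauto. }
  assert (Hin : forall v, In v u <-> In v s /\ 0 < b v)
    by (intros v; rewrite (Hsame v), filter_In, HP; tauto).
  assert (Hz : forall v, In v s -> ~ In v u -> b v = 0).
  { intros v Hv Hn. rewrite Hin in Hn. pose proof (proj1 Hb v Hv).
    destruct (Rlt_dec 0 (b v)); [tauto|lra]. }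
  exists u. repeat split; auto.
  - intros v Hv. apply Hin; auto.
  - intros v Hv. apply Hin in Hv. lra.
  - rewrite <- (proj1 (proj2 Hb)). symmetry. apply wsum_sub; auto.
    + apply (H1 s Hs).
    + apply (H1 u Hu).
    + intros v Hv. apply Hin; auto.
  - intros j. rewrite (proj2 (proj2 Hb)). apply wsum_sub.
    + apply (H1 s Hs).
    + apply (H1 u Hu).
    + intros v Hv. apply Hin; auto.
    + intros v Hv Hn. rewrite (Hz v Hv Hn). ring.
  - intros v Hv. apply Hin; auto.
Qed.

Lemma same_simplex (n : nat) (K : list simplex) (s t : simplex) :
  sc_complex n K -> In s K -> In t K -> incl s t -> (length t <= length s)%nat -> s = t.
Proof.
  intros HK Hs Ht Hi Hl. apply HK; auto. intros v. split; [apply Hi|].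
  apply (NoDup_length_incl (complex_nodup n K s HK Hs) Hl Hi).
Qed.

(** The two simplices meet in a common face containing [x]. All coordinates of [x] in [s] are
    positive, so this face has every vertex of [s], and the length bound then identifies [s] with
    [u]. *)
Lemma interior_unique (n : nat) (K : list simplex) (s u : simplex) (x : pt) :
  sc_complex n K -> In s K -> In u K -> (length u <= length s)%nat ->
  osimp s x -> csimp u x -> s = u.
Proof.
  intros HK Hs Hu Hl (b & Hb & Hpos) Hx.
  apply (same_simplex n K); auto.
  destruct HK as (H1 & H2 & H3 & H4).
  destruct (H4 s u Hs Hu) as (w & Hw & Hws & Hwu & Hcap).
  { exists x. split; auto. exists b; auto. }
  destruct (proj1 (Hcap x)) as (c & Hc); [split; auto; exists b; auto|].
  destruct (H1 s Hs) as (_ & Hind & _).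
  destruct (bary_incl w s c x (proj1 Hind) Hws Hc) as (c' & Hc' & Hz).
  intros v Hv. apply Hwu. apply NNPP. intros Hn.
  specialize (Hpos v Hv). rewrite (bary_unique s b c' x Hind Hb Hc' v Hv), Hz in Hpos; auto.
  lra.
Qed.

(** The face [u] is where the coordinates of [s] off [u] vanish. Such a coordinate is nonnegative
    and affine on [c], so vanishing at an interior point of [c] it vanishes at every vertex of
    [c]. *)
Lemma in_facet (n : nat) (K : list simplex) (s u : simplex) (c : simplex) (x : pt) :
  sc_complex n K -> In s K -> In u K -> incl u s -> NoDup c -> subset c s ->
  osimp c x -> csimp u x -> subset c u.
Proof.
  intros HK Hs Hu Hus Hnd Hcs (p & Hp & Hpos) (q & Hq).
  pose proof (complex_indep n K s HK Hs) as Hind.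
  pose proof (complex_nodup n K u HK Hu) as Hndu.
  set (B := fun v => epsilon (inhabits (fun _ : pt => 0)) (fun b => bary s b v)).
  assert (HB : forall v, In v c -> bary s (B v) v).
  { intros v Hv. unfold B. apply epsilon_spec, Hcs, csimp_vertex; auto. }
  destruct (bary_incl u s q x (proj1 Hind) Hus Hq) as (q' & Hq' & Hz).
  pose proof (bary_comp c s p B x Hp HB) as Hx.
  refine (csimp_comp c u _). intros v Hv. exists (B v). apply (bary_sub u s); auto.
  - apply Hind.
  - intros w Hw Hn.
    assert (E : wsum (fun v => p v * B v w) c = 0).
    { rewrite <- (Hz w Hn). apply (bary_unique s _ _ x Hind Hx Hq' w Hw). }
    assert (Hterm : forall v, In v c -> 0 <= p v * B v w).
    { intros v' Hv'. apply Rmult_le_pos; [left; auto|apply (HB v' Hv'); auto]. }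
    pose proof (wsum_term_le (fun v => p v * B v w) c v Hterm Hv) as Hle. simpl in Hle.
    specialize (Hterm v Hv). specialize (Hpos v Hv).
    assert (p v * B v w = 0) as Hmul by lra.
    apply Rmult_integral in Hmul. lra.
Qed.

(** A coordinate of [t] vanishing at [x] would vanish at every vertex of [c], placing [c] in a facet
    of [t], which has too few vertices. *)
Lemma subset_interior (c t : simplex) (x : pt) :
  aff_indep c -> aff_indep t -> (length t <= length c)%nat -> subset c t ->
  osimp c x -> osimp t x.
Proof.
  intros Hc Ht Hl Hct (p & Hp & Hpos).
  set (B := fun v => epsilon (inhabits (fun _ : pt => 0)) (fun b => bary t b v)).
  assert (HB : forall v, In v c -> bary t (B v) v).
  { intros v Hv. unfold B. apply epsilon_spec, Hct, csimp_vertex; auto. apply Hc. }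
  exists (fun w => wsum (fun v => p v * B v w) c). split; [apply bary_comp; auto|].
  intros w Hw.
  assert (Hterm : forall v, In v c -> 0 <= p v * B v w).
  { intros v Hv. apply Rmult_le_pos; [left; auto|apply (HB v Hv); auto]. }
  destruct (wsum_nonneg _ _ Hterm) as [|E]; auto. exfalso.
  assert (Hz : forall v, In v c -> B v w = 0).
  { intros v Hv. pose proof (wsum_term_le _ c v Hterm Hv) as Hle. simpl in Hle.
    specialize (Hterm v Hv). specialize (Hpos v Hv).
    assert (p v * B v w = 0) as Hmul by lra.
    apply Rmult_integral in Hmul. lra. }
  destruct (in_perm_cons w t Hw) as (t' & Hperm).
  pose proof (Permutation_length Hperm) as Hlen; simpl in Hlen.
  enough (length c <= length t')%nat by lia.
  apply (rank_le c t' B Hc). intros v Hv.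
  destruct (HB v Hv) as (_ & H1 & H2). specialize (Hz v Hv). split.
  - rewrite <- H1, (wsum_perm _ _ _ Hperm). simpl. rewrite Hz. ring.
  - intros j. rewrite H2, !lincomb_eq, (wsum_perm _ _ _ Hperm). simpl. rewrite Hz. ring.
Qed.

(** * Top-dimensional simplices through a given point *)

Lemma in_top_simplex (n d : nat) (K : list simplex) (x : pt) :
  sc_complex n K -> everywhere_dim d K -> polyh K x ->
  exists t, In t K /\ length t = S d /\ csimp t x.
Proof.
  intros HK (L & HL & Hpoly) Hx.
  (* The d-simplices in [L] need not belong to [K], so the covering argument runs both ways: [L]
     covers each simplex of [K], which bounds dimensions above, and [K] covers the member of [L]
     through [x], which bounds one of them below. *)
  assert (Hbound : forall t, In t K -> (length t <= S d)%nat).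
  { intros t Ht. destruct (proj1 HK t Ht) as (Hne & Hind & _).
    destruct t as [|v t]; [congruence|].
    destruct (cover_full_dim L (fun _ => True) (v :: t) v) as (l & Hl & _ & _ & Hlen); auto.
    - intros c Hc. apply (HL c Hc).
    - intros y Hy. destruct (proj1 (Hpoly y)) as (l & Hl & Hy'); [exists (v :: t); auto|].
      exists l; auto.
    - apply csimp_vertex; [apply Hind|left; auto].
    - rewrite <- (proj2 (HL l Hl)). auto. }
  destruct (proj1 (Hpoly x) Hx) as (l & Hl & Hxl). destruct (HL l Hl) as [Hind Hlen].
  destruct (cover_full_dim K (fun _ => True) l x) as (t & Ht & _ & Hxt & Hle); auto.
  - intros c Hc. apply (complex_indep n K c HK Hc).
  - intros y Hy. destruct (proj2 (Hpoly y)) as (t & Ht & Hy'); [exists l; auto|].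
    exists t; auto.
  - exists t. split; auto. split; auto. specialize (Hbound t Ht). lia.
Qed.

(** The simplices of [Ks] inside [t] cover [t], since the carrier in [Ks] of any point of [t] lies
    in [t]. Then [cover_full_dim] gives one through [x] of at least the dimension of [t], and
    [rank_le] excludes more. *)
Lemma subdivision_top_simplex (n : nat) (K Ks : list simplex) (t : simplex) (x : pt) :
  sc_complex n K -> pl_subdivision n Ks K -> In t K -> csimp t x ->
  exists s, In s Ks /\ length s = length t /\ subset s t /\ csimp s x.
Proof.
  intros HK (HKs & Hsub & Hpoly) Ht Hx.
  pose proof (complex_indep n K t HK Ht) as Hind.
  destruct (cover_full_dim Ks (fun c => subset c t) t x) as (s & Hs & Hst & Hxs & Hle); auto.
  - intros c Hc. apply (complex_indep n Ks c HKs Hc).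
  - intros y Hy. destruct (proj2 (Hpoly y)) as (s & Hs & b & Hb); [exists t; auto|].
    destruct (carrier n Ks s b y HKs Hs Hb) as (c & Hc & Hcs & Hbc & Hpos & _).
    destruct (Hsub s Hs) as (t' & Ht' & Hst').
    pose proof (complex_nodup n Ks s HKs Hs) as Hnds.
    destruct HK as (H1 & H2 & H3 & H4).
    destruct (H4 t t' Ht Ht') as (u & Hu & Hut & Hut' & Hcap).
    { exists y. split; auto. apply Hst'. exists b; auto. }
    exists c. split; auto. split; [|exists b; auto].
    (* The carrier [c] lies in some [t'] of [K] and has the interior point [y] in the common face
       [u] of [t] and [t'], so all of [c] lies in [u]. *)
    assert (Hcu : subset c u).
    { apply (in_facet n K t' u c y); auto.
      - split; auto.
      - apply (complex_nodup n Ks c HKs Hc).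
      - intros z Hz. apply Hst', (csimp_incl c); auto.
      - exists b; auto.
      - apply Hcap. split; auto. apply Hst'. exists b; auto. }
    intros z Hz. apply (csimp_incl u); auto. apply Hind.
  - exists s. split; auto. split; auto.
    enough (length s <= length t)%nat by lia.
    pose proof (complex_indep n Ks s HKs Hs) as Hinds.
    set (B := fun v => epsilon (inhabits (fun _ : pt => 0)) (fun b => bary t b v)).
    apply (rank_le s t B Hinds). intros v Hv.
    assert (HB : bary t (B v) v).
    { unfold B. apply epsilon_spec, Hst, csimp_vertex; auto. apply Hinds. }
    apply HB.
Qed.

(** Otherwise the carriers of [v] and [v'] are faces of [t] without common vertex, hence disjoint,
    and [s] meets both, against properness. *)
Lemma proper_common_vertex (n : nat) (K Ks : list simplex) (s t : simplex)
  (v v' : pt) (b b' : pt -> R) :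
  sc_complex n K -> sc_complex n Ks -> proper_sub Ks K -> In s Ks -> In t K ->
  In v s -> In v' s -> bary t b v -> bary t b' v' ->
  exists w, In w t /\ 0 < b w /\ 0 < b' w.
Proof.
  intros HK HKs Hprop Hs Ht Hv Hv' Hb Hb'. apply NNPP. intros Hn.
  pose proof (complex_indep n K t HK Ht) as Hind.
  pose proof (complex_nodup n Ks s HKs Hs) as Hnd.
  destruct (carrier n K t b v HK Ht Hb) as (u & Hu & Hut & Hbu & Hpos & _).
  destruct (carrier n K t b' v' HK Ht Hb') as (u' & Hu' & Hut' & Hbu' & Hpos' & _).
  apply (Hprop s u u' Hs Hu Hu').
  - intros x ((p & Hp) & (p' & Hp')).
    destruct (bary_incl u t p x (proj1 Hind) Hut Hp) as (q & Hq & Hz).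
    destruct (bary_incl u' t p' x (proj1 Hind) Hut' Hp') as (q' & Hq' & Hz').
    destruct (bary_nonempty t q x Hq) as (w & Hw & Hqw).
    apply Hn. exists w. split; auto. split.
    + apply Hpos. apply NNPP. intros H. rewrite (Hz w H) in Hqw. lra.
    + apply Hpos'. apply NNPP. intros H.
      rewrite (bary_unique t q q' x Hind Hq Hq' w Hw), (Hz' w H) in Hqw. lra.
  - split.
    + exists v. split; [apply csimp_vertex; auto|exists b; auto].
    + exists v'. split; [apply csimp_vertex; auto|exists b'; auto].
Qed.

(** Each choice of [s], [t], [v], [v'] admits every constant below the smaller of two positive
    coordinates, and there are finitely many choices. *)
Lemma uniform_overlap (n : nat) (K Ks : list simplex) :
  sc_complex n K -> sc_complex n Ks -> proper_sub Ks K ->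
  exists k, 0 < k < 1 /\ forall s t v v' b b', In s Ks -> In t K -> In v s -> In v' s ->
    bary t b v -> bary t b' v' -> exists w, In w t /\ k <= b w /\ k <= b' w.
Proof.
  intros HK HKs Hprop.
  set (P := fun t v v' k => forall b b', bary t b v -> bary t b' v' ->
              exists w, In w t /\ k <= b w /\ k <= b' w).
  destruct (small_witness (fun k => forall s, In s Ks -> forall t, In t K ->
              forall v, In v s -> forall v', In v' s -> P t v v' k)) as (k & Hk & H).
  - apply (small_all Ks (fun s k => forall t, In t K ->
              forall v, In v s -> forall v', In v' s -> P t v v' k)); intros s Hs.
    apply (small_all K (fun t k => forall v, In v s -> forall v', In v' s -> P t v v' k));
      intros t Ht.
    apply (small_all s (fun v k => forall v', In v' s -> P t v v' k)); intros v Hv.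
    apply (small_all s (fun v' k => P t v v' k)); intros v' Hv'.
    pose proof (complex_indep n K t HK Ht) as Hind.
    destruct (classic (csimp t v /\ csimp t v')) as [((b & Hb) & (b' & Hb'))|Hno].
    + destruct (proper_common_vertex n K Ks s t v v' b b') as (w & Hw & Hbw & Hbw'); auto.
      exists (Rmin (b w) (b' w)). split; [apply Rmin_glb_lt; auto|].
      intros k Hk c c' Hc Hc'. exists w.
      rewrite <- (bary_unique t b c v Hind Hb Hc w Hw),
        <- (bary_unique t b' c' v' Hind Hb' Hc' w Hw).
      pose proof (Rmin_l (b w) (b' w)). pose proof (Rmin_r (b w) (b' w)).
      split; [auto|lra].
    + exists 1. split; [lra|]. intros k _ b b' Hb Hb'. exfalso. apply Hno.
      split; [exists b|exists b']; auto.
  - exists k. split; auto. intros s t v v' b b' Hs Ht Hv Hv'. apply (H s Hs t Ht v Hv v' Hv').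
Qed.

(** * Functions affine on a simplex *)

(** Affinity on one simplex only. Unlike [affine], this can be transported along [g], which is
    affine just simplex by simplex. *)
Definition aff_on (t : simplex) (Phi : pt -> R) : Prop :=
  forall b x, bary t b x -> Phi x = wsum (fun w => b w * Phi w) t.

(** For [x] outside the simplex the value is an arbitrary choice. *)
Definition coord (s : simplex) (x : pt) : pt -> R :=
  epsilon (inhabits (fun _ : pt => 0)) (fun b => bary s b x).

Lemma coord_bary (s : simplex) (x : pt) : csimp s x -> bary s (coord s x) x.
Proof. intros H. exact (epsilon_spec _ (fun b => bary s b x) H). Qed.

Lemma coord_eq (s : simplex) (b : pt -> R) (x v : pt) :
  aff_indep s -> bary s b x -> In v s -> coord s x v = b v.
Proof.
  intros Hs Hb Hv. apply (bary_unique s _ _ x); auto. apply coord_bary. exists b; auto.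
Qed.

Lemma coord_vertex (s : simplex) (u v : pt) :
  aff_indep s -> In u s -> In v s -> coord s u v = delta u v.
Proof. intros Hs Hu Hv. apply coord_eq; auto. apply bary_vertex; auto. apply Hs. Qed.

Lemma aff_on_coord (s : simplex) (v : pt) :
  aff_indep s -> In v s -> aff_on s (fun x => coord s x v).
Proof.
  intros Hs Hv b x Hb. rewrite (coord_eq s b x v) by auto.
  rewrite (wsum_ext _ (fun w => delta v w * b w)).
  - rewrite wsum_delta; auto. apply Hs.
  - intros w Hw. rewrite coord_vertex by auto.
    unfold delta. destruct (peq w v), (peq v w); try congruence; ring.
Qed.

Lemma aff_on_proj (s : simplex) (j : nat) : aff_on s (fun x => x j).
Proof. intros b x Hb. apply Hb. Qed.

Lemma aff_on_subset (s t : simplex) (Phi : pt -> R) :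
  NoDup s -> subset s t -> aff_on t Phi -> aff_on s Phi.
Proof.
  intros Hs Hst HPhi p x Hp.
  assert (HB : forall v, In v s -> bary t (coord t v) v)
    by (intros v Hv; apply coord_bary, Hst, csimp_vertex; auto).
  rewrite (HPhi _ _ (bary_comp s t p (coord t) x Hp HB)), combine_wsum.
  apply wsum_ext. intros v Hv. rewrite <- (HPhi _ _ (HB v Hv)). reflexivity.
Qed.

Lemma aff_on_bounds (s : simplex) (Phi : pt -> R) (a D : R) (x : pt) :
  aff_on s Phi -> (forall v, In v s -> a <= Phi v <= a + D) -> csimp s x ->
  a <= Phi x <= a + D.
Proof.
  intros HPhi H (b & Hb). rewrite (HPhi b x Hb).
  destruct Hb as (H0 & H1 & _).
  assert (E : forall c, c = wsum (fun v => b v * c) s).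
  { intros c. rewrite (wsum_ext _ (fun v => c * b v)) by (intros; ring).
    rewrite wsum_scal, H1. ring. }
  split.
  - rewrite (E a). apply wsum_le. intros v Hv. apply Rmult_le_compat_l; auto. apply H; auto.
  - rewrite (E (a + D)) at 1.
    apply wsum_le. intros v Hv. apply Rmult_le_compat_l; auto. apply H; auto.
Qed.

Lemma list_min (Phi : pt -> R) (s : simplex) :
  s <> [] -> exists v0, In v0 s /\ forall v, In v s -> Phi v0 <= Phi v.
Proof.
  induction s as [|u s IH]; [congruence|]. intros _.
  destruct s as [|u' s].
  - exists u. split; [left; auto|]. intros v [<-|[]]. lra.
  - destruct IH as (v0 & Hv0 & Hmin); [discriminate|].
    destruct (Rle_dec (Phi u) (Phi v0)).
    + exists u. split; [left; auto|]. intros v [<-|Hv]; [lra|].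
      specialize (Hmin v Hv). lra.
    + exists v0. split; [right; auto|]. intros v [<-|Hv]; [lra|auto].
Qed.

(** Compare any [v] with the vertex [v0] of least value. At a common vertex [w] both have weight at
    least [k], which pulls [Phi v] below [a + D] by [k * (a + D - Phi w)] and lifts [Phi v0] above
    [a] by [k * (Phi w - a)]; the two gains add up to [k * D]. *)
Lemma contract_range (k : R) (s t : simplex) (Phi : pt -> R) (a D : R) :
  NoDup s ->
  (forall v v' b b', In v s -> In v' s -> bary t b v -> bary t b' v' ->
     exists w, In w t /\ k <= b w /\ k <= b' w) ->
  subset s t -> aff_on t Phi -> (forall w, In w t -> a <= Phi w <= a + D) ->
  exists a', forall v, In v s -> a' <= Phi v <= a' + (1 - k) * D.
Proof.
  intros Hs Hk Hst HPhi H. destruct s as [|u s'] eqn:Es.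
  { exists 0. intros v []. }
  rewrite <- Es in *. destruct (list_min Phi s) as (v0 & Hv0 & Hmin); [congruence|].
  exists (Phi v0). intros v Hv. split; auto.
  destruct (Hst v (csimp_vertex s v Hs Hv)) as (b & Hb).
  destruct (Hst v0 (csimp_vertex s v0 Hs Hv0)) as (b' & Hb').
  destruct (Hk v v0 b b') as (w & Hw & Hbw & Hbw'); auto.
  assert (E1 : a + D - Phi v = wsum (fun w => b w * (a + D - Phi w)) t).
  { rewrite (wsum_ext _ (fun w => (a + D) * b w - b w * Phi w)) by (intros; ring).
    rewrite wsum_minus, wsum_scal, <- (HPhi b v Hb), (proj1 (proj2 Hb)). ring. }
  assert (E2 : Phi v0 - a = wsum (fun w => b' w * (Phi w - a)) t).
  { rewrite (wsum_ext _ (fun w => b' w * Phi w - a * b' w)) by (intros; ring).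
    rewrite wsum_minus, wsum_scal, <- (HPhi b' v0 Hb'), (proj1 (proj2 Hb')). ring. }
  assert (L1 : b w * (a + D - Phi w) <= a + D - Phi v).
  { rewrite E1. apply (wsum_term_le (fun w => b w * (a + D - Phi w)) t w); auto.
    intros u' Hu'. apply Rmult_le_pos; [apply Hb; auto|]. specialize (H u' Hu'); lra. }
  assert (L2 : b' w * (Phi w - a) <= Phi v0 - a).
  { rewrite E2. apply (wsum_term_le (fun w => b' w * (Phi w - a)) t w); auto.
    intros u' Hu'. apply Rmult_le_pos; [apply Hb'; auto|]. specialize (H u' Hu'); lra. }
  specialize (H w Hw).
  assert (k * (a + D - Phi w) <= b w * (a + D - Phi w)) by (apply Rmult_le_compat_r; lra).
  assert (k * (Phi w - a) <= b' w * (Phi w - a)) by (apply Rmult_le_compat_r; lra).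
  lra.
Qed.

(** * Limits *)

Lemma Rabs_le_bounds (x a : R) : Rabs x <= a -> - a <= x <= a.
Proof. unfold Rabs. destruct (Rcase_abs x); lra. Qed.

Lemma Un_cv_eventually (u v : nat -> R) (l : R) (N : nat) :
  (forall m, (N <= m)%nat -> u m = v m) -> Un_cv u l -> Un_cv v l.
Proof.
  intros E H eps Heps. destruct (H eps Heps) as (M & HM).
  exists (max N M). intros m Hm. rewrite <- E by lia. apply HM. lia.
Qed.

Lemma Un_cv_const (c : R) : Un_cv (fun _ => c) c.
Proof.
  intros eps Heps. exists 0%nat. intros m _. rewrite (proj2 (R_dist_refl c c) eq_refl). auto.
Qed.

Lemma Un_cv_nonneg (u : nat -> R) (l : R) (N : nat) :
  (forall m, (N <= m)%nat -> 0 <= u m) -> Un_cv u l -> 0 <= l.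
Proof.
  intros H Hu. apply Rnot_lt_le. intros Hl.
  destruct (Hu (- l)) as (M & HM); [lra|].
  specialize (HM (max N M) ltac:(lia)). specialize (H (max N M) ltac:(lia)).
  unfold Rdist in HM. apply Rabs_def2 in HM. lra.
Qed.

Lemma Un_cv_wsum (u : pt -> nat -> R) (l F : pt -> R) (s : simplex) :
  (forall v, In v s -> Un_cv (u v) (l v)) ->
  Un_cv (fun m => wsum (fun v => u v m * F v) s) (wsum (fun v => l v * F v) s).
Proof.
  induction s as [|v s IH]; intros H.
  - exact (Un_cv_const 0).
  - simpl. apply (CV_plus (fun m => u v m * F v) (fun m => wsum (fun v => u v m * F v) s)).
    + apply (CV_mult (u v) (fun _ => F v)); [apply H; left; auto|apply Un_cv_const].
    + apply IH. intros w Hw. apply H. right; auto.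
Qed.

Lemma geometric_small (q D eps : R) :
  0 < q < 1 -> 0 < eps -> exists N, forall m, (N <= m)%nat -> q ^ m * D < eps.
Proof.
  intros Hq Heps.
  (* Adding 1 keeps the denominator positive even when [D] is zero. *)
  destruct (pow_lt_1_zero q) with (y := eps / (Rabs D + 1)) as (N & HN).
  - rewrite Rabs_right; lra.
  - apply Rdiv_lt_0_compat; auto. pose proof (Rabs_pos D). lra.
  - exists N. intros m Hm. specialize (HN m Hm).
    assert (Hp : 0 < q ^ m) by (apply pow_lt; lra).
    rewrite Rabs_right in HN by lra.
    pose proof (Rle_abs D). pose proof (Rabs_pos D).
    apply Rle_lt_trans with (q ^ m * (Rabs D + 1)); [apply Rmult_le_compat_l; lra|].
    apply Rlt_le_trans with (eps / (Rabs D + 1) * (Rabs D + 1)).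
    + apply Rmult_lt_compat_r; lra.
    + right. field. lra.
Qed.

(** * The dynamics *)

Lemma map_nodup_inj (f : pt -> pt) (s : simplex) (u v : pt) :
  NoDup (map f s) -> In u s -> In v s -> f u = f v -> u = v.
Proof.
  induction s as [|w s IH]; simpl; intros Hnd; [intros []|].
  inversion Hnd as [|? ? Hn Hs]; subst.
  intros [<-|Hu] [<-|Hv] E; auto; exfalso; apply Hn.
  - rewrite E. apply in_map; auto.
  - rewrite <- E. apply in_map; auto.
Qed.

Lemma iter_shift (g : pt -> pt) (i : nat) (x : pt) :
  Nat.iter i g (g x) = Nat.iter (S i) g x.
Proof. induction i as [|i IH]; simpl; [reflexivity|]. rewrite IH. reflexivity. Qed.

Section Dynamics.

Variables (n d : nat) (K Ks : list simplex) (gam g : pt -> pt).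
Hypothesis HK : sc_complex n K.
Hypothesis Hsub : pl_subdivision n Ks K.
Hypothesis Hsim : simplicial_map Ks K gam.
Hypothesis Hnondeg : nondegenerate Ks K gam.
Hypothesis Hpl : assoc_pl Ks gam g.

Let HKs : sc_complex n Ks := proj1 Hsub.

(** Non-degeneracy gives both vertex lists the same length, so [gam] is injective on the vertices of
    [s]. *)
Lemma image_perm (s t : simplex) :
  In s Ks -> In t K -> same_set t (map gam s) ->
  Permutation t (map gam s) /\ NoDup (map gam s).
Proof.
  intros Hs Ht Hst.
  pose proof (complex_nodup n K t HK Ht) as Hnd.
  assert (NoDup (map gam s)).
  { apply (NoDup_incl_NoDup Hnd).
    - rewrite length_map, (Hnondeg s t); auto.
    - intros v Hv. apply Hst; auto. }
  split; auto. apply NoDup_Permutation; auto.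
Qed.

Lemma g_vertex (s : simplex) (v : pt) : In s Ks -> In v s -> g v = gam v.
Proof.
  intros Hs Hv. pose proof (complex_nodup n Ks s HKs Hs) as Hnd.
  apply functional_extensionality; intros j.
  rewrite (Hpl s (delta v) v Hs (bary_vertex s v Hnd Hv)), lincomb_eq.
  apply (wsum_delta (fun w => gam w j)); auto.
Qed.

Lemma push_bary (s t : simplex) (b : pt -> R) (x : pt) :
  In s Ks -> In t K -> same_set t (map gam s) -> bary s b x ->
  exists c, bary t c (g x) /\ forall v, In v s -> c (gam v) = b v.
Proof.
  intros Hs Ht Hst Hb. destruct (image_perm s t Hs Ht Hst) as [Hperm Hnd].
  pose proof (complex_nodup n Ks s HKs Hs) as Hnds.
  (* The coordinates [b] relabelled by [gam]; by injectivity only one term survives at each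
     vertex. *)
  set (c := fun w => wsum (fun v => delta (gam v) w * b v) s).
  assert (Hc : forall v, In v s -> c (gam v) = b v).
  { intros v Hv. unfold c. rewrite <- (wsum_delta b s v) by auto.
    apply wsum_ext. intros u Hu. f_equal.
    destruct (peq v u) as [->|Hne]; [rewrite !delta_same; auto|].
    rewrite !delta_diff; auto. intros E. apply Hne. symmetry.
    eapply map_nodup_inj; eauto. }
  exists c. split; auto. split; [|split].
  - intros w Hw. apply Hst, in_map_iff in Hw as (v & <- & Hv).
    rewrite Hc by auto. apply Hb; auto.
  - rewrite (wsum_perm _ _ _ Hperm), wsum_map, (wsum_ext _ b) by auto. apply Hb.
  - intros j. rewrite (Hpl s b x Hs Hb), !lincomb_eq, (wsum_perm _ _ _ Hperm), wsum_map.
    apply wsum_ext. intros v Hv. rewrite Hc; auto.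
Qed.

Lemma g_csimp (s t : simplex) (x : pt) :
  In s Ks -> In t K -> same_set t (map gam s) -> csimp s x -> csimp t (g x).
Proof.
  intros Hs Ht Hst (b & Hb). destruct (push_bary s t b x) as (c & Hc & _); auto.
  exists c; auto.
Qed.

Lemma pull_back (s t : simplex) (y : pt) :
  In s Ks -> In t K -> same_set t (map gam s) -> csimp t y ->
  exists x, csimp s x /\ g x = y.
Proof.
  intros Hs Ht Hst (c & C0 & C1 & C2). destruct (image_perm s t Hs Ht Hst) as [Hperm _].
  set (x := lincomb (fun v => c (gam v)) (fun v => v) s).
  assert (Hx : bary s (fun v => c (gam v)) x).
  { split; [|split].
    - intros v Hv. apply C0, Hst, in_map; auto.
    - rewrite <- (wsum_map c), <- (wsum_perm _ _ _ Hperm). auto.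
    - intros j. reflexivity. }
  exists x. split; [exists (fun v => c (gam v)); auto|].
  apply functional_extensionality; intros j.
  rewrite (Hpl s _ x Hs Hx), C2, !lincomb_eq, (wsum_perm _ _ _ Hperm), wsum_map. reflexivity.
Qed.

(** [Psi] is [Phi] composed with the inverse of the affine bijection induced by [g] from [s] to [t].
    It takes the same vertex values, so its range does not grow. *)
Lemma push_affine (s t : simplex) (Phi : pt -> R) :
  In s Ks -> In t K -> same_set t (map gam s) -> aff_on s Phi ->
  exists Psi, aff_on t Psi /\ (forall x, csimp s x -> Psi (g x) = Phi x) /\
    forall w, In w t -> exists v, In v s /\ Psi w = Phi v.
Proof.
  intros Hs Ht Hst HPhi. destruct (image_perm s t Hs Ht Hst) as [Hperm _].
  pose proof (complex_nodup n Ks s HKs Hs) as Hnds.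
  pose proof (complex_indep n K t HK Ht) as Hind.
  set (Psi := fun y => wsum (fun v => coord t y (gam v) * Phi v) s).
  assert (HPsi : forall c y, bary t c y -> Psi y = wsum (fun v => c (gam v) * Phi v) s).
  { intros c y Hc. apply wsum_ext. intros v Hv.
    rewrite (coord_eq t c y); auto. apply Hst, in_map; auto. }
  assert (Hpush : forall x, csimp s x -> Psi (g x) = Phi x).
  { intros x (b & Hb). destruct (push_bary s t b x) as (c & Hc & Hcb); auto.
    rewrite (HPsi c _ Hc), (HPhi b x Hb). apply wsum_ext.
    intros v Hv. rewrite Hcb; auto. }
  assert (Hvert : forall v, In v s -> Psi (gam v) = Phi v).
  { intros v Hv. rewrite <- (g_vertex s v) by auto. apply Hpush, csimp_vertex; auto. }
  exists Psi. split; [|split]; auto.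
  - intros c y Hc. rewrite (HPsi c y Hc), (wsum_perm _ _ _ Hperm), wsum_map.
    apply wsum_ext. intros v Hv. rewrite Hvert; auto.
  - intros w Hw. apply Hst, in_map_iff in Hw as (v & <- & Hv). exists v. auto.
Qed.

Notation Sig := (Sigma d Ks K gam).

Lemma Sigma_shift (sq : nat -> simplex) : Sig sq -> Sig (shift sq).
Proof. intros H i. apply (H (S i)). Qed.

Lemma Sigma_tail (i : nat) (sq : nat -> simplex) : Sig sq -> Sig (fun j => sq (j + i)%nat).
Proof. intros H j. apply (H (j + i)%nat). Qed.

Lemma Sigma_indep (sq : nat -> simplex) (i : nat) : Sig sq -> aff_indep (sq i).
Proof. intros H. apply (complex_indep n Ks); auto. apply (H i). Qed.

(** * Contraction along an itinerary and the coded point *)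

Variable k : R.
Hypothesis Hk : 0 < k < 1.
Hypothesis Hoverlap : forall s t v v' b b', In s Ks -> In t K -> In v s -> In v' s ->
  bary t b v -> bary t b' v' -> exists w, In w t /\ k <= b w /\ k <= b' w.

(** Push [Phi] forward to the image of the first simplex, where its range is unchanged, and restrict
    to the next simplex, where the range shrinks by [1 - k]. The induction continues with the
    shifted itinerary and the new function. *)
Lemma contraction (m : nat) : forall sq Phi a D x y,
  Sig sq -> aff_on (sq 0%nat) Phi -> (forall v, In v (sq 0%nat) -> a <= Phi v <= a + D) ->
  (forall i, (i <= m)%nat -> csimp (sq i) (Nat.iter i g x) /\ csimp (sq i) (Nat.iter i g y)) ->
  Rabs (Phi x - Phi y) <= (1 - k) ^ m * D.
Proof.
  induction m as [|m IH]; intros sq Phi a D x y Hsq HPhi Hr Hit.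
  - destruct (Hit 0%nat (le_n _)) as [Hx Hy]; simpl in Hx, Hy.
    pose proof (aff_on_bounds _ _ a D x HPhi Hr Hx).
    pose proof (aff_on_bounds _ _ a D y HPhi Hr Hy).
    simpl. apply Rabs_le. lra.
  - destruct (Hsq 0%nat) as (Hs & _ & t & Ht & Hst & Hnext).
    destruct (push_affine (sq 0%nat) t Phi) as (Psi & HPsi & Hpush & Hvert); auto.
    destruct (Hsq 1%nat) as (Hs1 & _ & _).
    pose proof (complex_nodup n Ks _ HKs Hs1) as Hnd1.
    destruct (contract_range k (sq 1%nat) t Psi a D) as (a' & Ha'); auto.
    { intros v v' b b'. apply Hoverlap; auto. }
    { intros w Hw. destruct (Hvert w Hw) as (v & Hv & ->). auto. }
    destruct (Hit 0%nat (Nat.le_0_l _)) as [Hx Hy]; simpl in Hx, Hy.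
    rewrite <- (Hpush x), <- (Hpush y) by auto.
    replace ((1 - k) ^ S m * D) with ((1 - k) ^ m * ((1 - k) * D)) by (simpl; ring).
    apply (IH (shift sq) Psi a').
    + apply Sigma_shift; auto.
    + apply (aff_on_subset _ t); auto.
    + exact Ha'.
    + intros i Hi. rewrite !iter_shift. apply (Hit (S i)). lia.
Qed.

(** A point for the shifted itinerary lies in the image of the first simplex, so it lifts through
    [g] to that simplex. *)
Lemma finite_itinerary_point (m : nat) : forall sq, Sig sq ->
  exists x, forall i, (i <= m)%nat -> csimp (sq i) (Nat.iter i g x).
Proof.
  induction m as [|m IH]; intros sq Hsq.
  - destruct (Hsq 0%nat) as (Hs & Hl & _). destruct (sq 0%nat) as [|v s] eqn:E; [discriminate|].
    exists v. intros i Hi. replace i with 0%nat by lia. rewrite E.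
    apply csimp_vertex; [|left; auto]. apply (complex_nodup n Ks _ HKs Hs).
  - destruct (IH (shift sq) (Sigma_shift sq Hsq)) as (y & Hy).
    destruct (Hsq 0%nat) as (Hs & _ & t & Ht & Hst & Hnext).
    destruct (pull_back (sq 0%nat) t y) as (x & Hx & <-); auto.
    { apply Hnext, (Hy 0%nat). lia. }
    exists x. intros [|i] Hi; auto. rewrite <- iter_shift. apply Hy. lia.
Qed.

(** Let [xs m] follow the itinerary up to time [m]. By contraction, the coordinates of its i-th
    iterate in [sq i] are Cauchy in [m]; the limits define points [z i] that form the required
    orbit. *)
Lemma itinerary_point (sq : nat -> simplex) : Sig sq -> exists x, Hgam K g sq x.
Proof.
  intros Hsq.
  set (xs := fun m => epsilon (inhabits (fun _ : nat => 0))
    (fun x => forall i, (i <= m)%nat -> csimp (sq i) (Nat.iter i g x))).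
  assert (Hxs : forall m i, (i <= m)%nat -> csimp (sq i) (Nat.iter i g (xs m))).
  { intros m. unfold xs. apply epsilon_spec. apply finite_itinerary_point; auto. }
  set (u := fun i v m => coord (sq i) (Nat.iter i g (xs m)) v).
  assert (Hu : forall i m, (i <= m)%nat ->
            bary (sq i) (fun v => u i v m) (Nat.iter i g (xs m))).
  { intros i m Him. apply coord_bary; auto. }
  assert (Hcauchy : forall i v, In v (sq i) -> Cauchy_crit (u i v)).
  { intros i v Hv eps Heps.
    (* A coordinate has range 1 on its simplex. From index [N + i] on, both points follow the
       itinerary for [N] steps after time [i]. *)
    destruct (geometric_small (1 - k) 1 eps) as (N & HN); [lra|auto|].
    exists (N + i)%nat. intros m m' Hm Hm'. unfold Rdist.
    eapply Rle_lt_trans; [|apply (HN N (le_n N))].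
    apply (contraction N (fun j => sq (j + i)%nat) (fun x => coord (sq i) x v) 0).
    - apply Sigma_tail; auto.
    - apply aff_on_coord; auto. apply Sigma_indep; auto.
    - simpl. intros w Hw. rewrite coord_vertex; auto using Sigma_indep.
      unfold delta. destruct (peq w v); lra.
    - intros j Hj. rewrite <- !Nat.iter_add. split; apply Hxs; lia. }
  set (l := fun i v => epsilon (inhabits 0) (fun r => Un_cv (u i v) r)).
  assert (Hl : forall i v, In v (sq i) -> Un_cv (u i v) (l i v)).
  { intros i v Hv. unfold l. apply epsilon_spec.
    destruct (R_complete (u i v) (Hcauchy i v Hv)) as (r & Hr). exists r; auto. }
  set (z := fun i => lincomb (l i) (fun v => v) (sq i)).
  assert (Hz : forall i, bary (sq i) (l i) (z i)).
  { intros i. split; [|split].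
    - intros v Hv. apply (Un_cv_nonneg (u i v) (l i v) i); auto.
      intros m Hm. apply (Hu i m Hm); auto.
    - apply (UL_sequence (fun m => wsum (fun v => u i v m * 1) (sq i))).
      + rewrite (wsum_ext (l i) (fun v => l i v * 1)) by (intros; ring).
        apply Un_cv_wsum; auto.
      + apply (Un_cv_eventually (fun _ => 1) _ 1 i); [|apply Un_cv_const].
        intros m Hm. rewrite (wsum_ext _ (fun v => u i v m)) by (intros; ring).
        symmetry. apply (Hu i m Hm).
    - intros j. reflexivity. }
  assert (Hlim : forall i j, Un_cv (fun m => Nat.iter i g (xs m) j) (z i j)).
  { intros i j.
    apply (Un_cv_eventually (fun m => wsum (fun v => u i v m * v j) (sq i)) _ _ i).
    - intros m Hm. symmetry. apply (Hu i m Hm).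
    - apply Un_cv_wsum; auto. }
  (* On [sq i] the map [g] is a fixed linear expression in the coordinates, so it passes to the
     limit. *)
  assert (Hgz : forall i, g (z i) = z (S i)).
  { intros i. apply functional_extensionality; intros j.
    apply (UL_sequence (fun m => Nat.iter (S i) g (xs m) j)); auto.
    apply (Un_cv_eventually (fun m => wsum (fun v => u i v m * gam v j) (sq i)) _ _ i).
    - intros m Hm. symmetry. apply (Hpl (sq i)); [apply (Hsq i)|apply (Hu i m Hm)].
    - rewrite (Hpl (sq i) (l i) (z i)); [|apply (Hsq i)|auto].
      apply Un_cv_wsum; auto. }
  assert (Hiter : forall i, Nat.iter i g (z 0%nat) = z i).
  { induction i as [|i IH]; simpl; auto. rewrite IH; auto. }
  exists (z 0%nat). split.
  - apply Hsub. exists (sq 0%nat). split; [apply (Hsq 0%nat)|exists (l 0%nat); auto].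
  - intros i. rewrite Hiter. exists (l i); auto.
Qed.

Lemma coordinate_range (s : simplex) (N : nat) :
  exists a D, forall j v, (j < N)%nat -> In v s -> a <= v j <= a + D.
Proof.
  enough (exists C, forall j v, (j < N)%nat -> In v s -> Rabs (v j) <= C) as (C & HC).
  { exists (- C), (2 * C). intros j v Hj Hv. specialize (HC j v Hj Hv).
    apply Rabs_le_bounds in HC. lra. }
  induction s as [|u s (C & IH)].
  - exists 0. intros j v _ [].
  - assert (exists C', forall j, (j < N)%nat -> Rabs (u j) <= C') as (C' & HC').
    { clear. induction N as [|N (C & IH)]; [exists 0; intros; lia|].
      exists (Rmax C (Rabs (u N))). intros j Hj.
      destruct (Nat.eq_dec j N) as [->|]; [apply Rmax_r|].
      eapply Rle_trans; [apply IH; lia|apply Rmax_l]. }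
    exists (Rmax C' C). intros j v Hj [<-|Hv].
    + eapply Rle_trans; [apply HC'; auto|apply Rmax_l].
    + eapply Rle_trans; [apply IH; auto|apply Rmax_r].
Qed.

Lemma itinerary_point_unique (sq : nat -> simplex) (x y : pt) :
  Sig sq -> (forall i, csimp (sq i) (Nat.iter i g x)) ->
  (forall i, csimp (sq i) (Nat.iter i g y)) -> x = y.
Proof.
  intros Hsq Hx Hy. apply functional_extensionality; intros j.
  (* [S j] makes coordinate [j] one of those bounded. *)
  destruct (coordinate_range (sq 0%nat) (S j)) as (a & D & Hr).
  enough (Rabs (x j - y j) <= 0) as H by (apply Rabs_le_bounds in H; lra).
  apply le_epsilon. intros eps Heps.
  destruct (geometric_small (1 - k) D eps) as (N & HN); [lra|auto|].
  pose proof (contraction N sq (fun x => x j) a D x y Hsq (aff_on_proj _ j)) as H.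
  simpl in H. specialize (HN N (le_n N)).
  assert (Rabs (x j - y j) <= (1 - k) ^ N * D) by (apply H; auto). lra.
Qed.

Lemma edist_le (N : nat) (x y : pt) (e : R) :
  (forall j, (j < N)%nat -> Rabs (x j - y j) <= e) -> edist N x y <= INR N * e.
Proof.
  intros H. unfold edist.
  assert (Hgen : forall l, (forall j, In j l -> Rabs (x j - y j) <= e) ->
    fold_right (fun j a => Rabs (x j - y j) + a) 0 l <= INR (length l) * e).
  { induction l as [|j l IH]; intros Hl; [simpl; lra|].
    change (length (j :: l)) with (S (length l)). rewrite S_INR. simpl.
    assert (Rabs (x j - y j) <= e) by (apply Hl; left; auto).
    assert (fold_right (fun j a => Rabs (x j - y j) + a) 0 l <= INR (length l) * e)
      by (apply IH; intros; apply Hl; right; auto).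
    lra. }
  rewrite <- (length_seq N 0) at 2. apply Hgen. intros j Hj. apply in_seq in Hj. apply H. lia.
Qed.

Lemma itinerary_continuous (sq : nat -> simplex) (x : pt) (eps : R) :
  Sig sq -> Hgam K g sq x -> 0 < eps ->
  exists m, forall tq y, agree m sq tq -> Hgam K g tq y -> edist n x y < eps.
Proof.
  intros Hsq [_ Hx] Heps.
  destruct (coordinate_range (sq 0%nat) n) as (a & D & Hr).
  destruct (geometric_small (1 - k) (INR n * D) eps) as (N & HN); [lra|auto|].
  (* Agreement below [S N] covers the times 0 to [N] required by [contraction]. *)
  exists (S N). intros tq y Hag [_ Hy].
  eapply Rle_lt_trans; [|apply (HN N (le_n N))].
  replace ((1 - k) ^ N * (INR n * D)) with (INR n * ((1 - k) ^ N * D)) by ring.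
  apply edist_le. intros j Hj.
  apply (contraction N sq (fun x => x j) a D x y Hsq (aff_on_proj _ j)).
  - auto.
  - intros i Hi. split; auto. rewrite (Hag i) by lia. auto.
Qed.

(** * Existence of itineraries *)

Lemma next_simplex (s : simplex) (x : pt) :
  In s Ks -> length s = S d -> csimp s x ->
  exists s', In s' Ks /\ length s' = S d /\ Gstar K gam s s' /\ csimp s' (g x).
Proof.
  intros Hs Hl Hx. destruct (Hsim s Hs) as (t & Ht & Hst).
  (* The image simplex [t] contains [g x] and is d-dimensional by non-degeneracy, so a d-simplex of
     [Ks] inside it contains [g x]. *)
  destruct (subdivision_top_simplex n K Ks t (g x)) as (s' & Hs' & Hl' & Hst' & Hx'); auto.
  { apply (g_csimp s); auto. }
  exists s'. split; auto. split; [|split]; auto.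
  - rewrite Hl', (Hnondeg s t); auto.
  - exists t. auto.
Qed.

Lemma itinerary_exists (s : simplex) (x : pt) :
  In s Ks -> length s = S d -> csimp s x ->
  exists sq, Sig sq /\ sq 0%nat = s /\ forall i, csimp (sq i) (Nat.iter i g x).
Proof.
  intros Hs Hl Hx.
  set (nxt := fun s x => epsilon (inhabits s)
    (fun s' => In s' Ks /\ length s' = S d /\ Gstar K gam s s' /\ csimp s' (g x))).
  set (sq := fix sq i := match i with
                         | O => s
                         | S i => nxt (sq i) (Nat.iter i g x)
                         end).
  assert (Hnxt : forall s x, In s Ks -> length s = S d -> csimp s x ->
    In (nxt s x) Ks /\ length (nxt s x) = S d /\ Gstar K gam s (nxt s x) /\ csimp (nxt s x) (g x)).
  { intros s0 x0 H1 H2 H3. unfold nxt. apply epsilon_spec. apply next_simplex; auto. }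
  assert (Hall : forall i, In (sq i) Ks /\ length (sq i) = S d /\ csimp (sq i) (Nat.iter i g x)).
  { induction i as [|i (H1 & H2 & H3)]; [auto|].
    destruct (Hnxt _ _ H1 H2 H3) as (G1 & G2 & _ & G4). auto. }
  exists sq. split; [|split]; auto.
  - intros i. destruct (Hall i) as (H1 & H2 & H3). split; auto. split; auto.
    apply (Hnxt _ _ H1 H2 H3).
  - intros i. apply Hall.
Qed.

(** * Orbits through open simplices and generic itineraries *)

Lemma interior_back (s s' : simplex) (x : pt) :
  In s Ks -> length s = S d -> In s' Ks -> length s' = S d -> Gstar K gam s s' ->
  csimp s x -> osimp s' (g x) -> osimp s x.
Proof.
  intros Hs Hl Hs' Hl' (t & Ht & Hst & Hs't) (b & Hb) Hint.
  pose proof (complex_indep n K t HK Ht) as Hind.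
  destruct (push_bary s t b x) as (c & Hc & Hcb); auto.
  (* By equal dimension, an interior point of [s'] is interior to [t]; the coordinates of [x] in [s]
     are those of [g x] in [t], hence positive. *)
  destruct (subset_interior s' t (g x)) as (c' & Hc' & Hpos); auto.
  { apply (complex_indep n Ks s' HKs Hs'). }
  { rewrite (Hnondeg s t), Hl, Hl'; auto. }
  exists b. split; auto. intros v Hv.
  assert (In (gam v) t) by (apply Hst, in_map; auto).
  rewrite <- Hcb, (bary_unique t c c' (g x)) by auto. auto.
Qed.

Lemma interior_back_iter (sq : nat -> simplex) (x : pt) (m : nat) :
  Sig sq -> (forall i, csimp (sq i) (Nat.iter i g x)) ->
  forall i, osimp (sq (m + i)%nat) (Nat.iter (m + i) g x) ->
  osimp (sq i) (Nat.iter i g x).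
Proof.
  intros Hsq Hx. induction m as [|m IH]; intros i Hint; auto.
  apply IH. destruct (Hsq (m + i)%nat) as (H1 & H2 & H3).
  destruct (Hsq (S (m + i))) as (H4 & H5 & _).
  apply (interior_back _ (sq (S (m + i)))); auto.
Qed.

Lemma barycenter (s : simplex) :
  s <> [] -> exists x, bary s (fun _ => / INR (length s)) x.
Proof.
  intros Hs. exists (lincomb (fun _ => / INR (length s)) (fun v => v) s).
  assert (0 < INR (length s)) by (apply lt_0_INR; destruct s; [congruence|simpl; lia]).
  split; [|split].
  - intros v _. left. apply Rinv_0_lt_compat; auto.
  - rewrite wsum_const. field. lra.
  - intros j. reflexivity.
Qed.

(* The cell of a long enough itinerary of the barycenter of [s] is so small that it stays
   inside the interior of [s]. *)
Lemma trapping_word : exists N, forall s, In s Ks -> length s = S d ->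
  exists sq, Sig sq /\ sq 0%nat = s /\
    forall y, (forall i, (i <= N)%nat -> csimp (sq i) (Nat.iter i g y)) -> osimp s y.
Proof.
  assert (Hd : 0 < / INR (S d)) by (apply Rinv_0_lt_compat, lt_0_INR; lia).
  (* All coordinates of a barycenter are [1 / (d + 1)]; a deviation below this keeps them positive.
     The same [N] serves all d-simplices. *)
  destruct (geometric_small (1 - k) 1 (/ INR (S d))) as (N & HN); [lra|auto|].
  exists N. intros s Hs Hl.
  destruct (barycenter s) as (x & Hb); [intros ->; discriminate|]. rewrite Hl in Hb.
  pose proof (complex_indep n Ks s HKs Hs) as Hind.
  destruct (itinerary_exists s x Hs Hl) as (sq & Hsq & E0 & Hx); [eexists; eauto|].
  exists sq. split; auto. split; auto. intros y Hy.
  assert (Hys : csimp s y) by (rewrite <- E0; apply (Hy 0%nat); lia).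
  exists (coord s y). split; [apply coord_bary; auto|]. intros v Hv.
  assert (H : Rabs (coord s x v - coord s y v) <= (1 - k) ^ N * 1).
  { apply (contraction N sq (fun x => coord s x v) 0); auto.
    - rewrite E0. apply aff_on_coord; auto.
    - rewrite E0. intros w Hw. rewrite coord_vertex by auto.
      unfold delta. destruct (peq w v); lra. }
  rewrite (coord_eq s _ x v Hind Hb Hv) in H. specialize (HN N (le_n N)).
  apply Rabs_le_bounds in H. lra.
Qed.

(* After time m, follow the trapping word of the current simplex to its end, then that of
   the simplex reached there, and so on. Since the union of the non-open parts is forward
   invariant, returning to an open simplex infinitely often means never leaving the open ones. *)
Lemma generic_extension (sq : nat -> simplex) (m : nat) :
  Sig sq -> exists tq, Sig tq /\ agree m sq tq /\
    forall y, (forall i, csimp (tq i) (Nat.iter i g y)) ->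
      forall i, osimp (tq i) (Nat.iter i g y).
Proof.
  intros Hsq. destruct trapping_word as (N & HN).
  set (W := fun s => epsilon (inhabits (fun _ : nat => s)) (fun sq => Sig sq /\ sq 0%nat = s /\
    forall y, (forall i, (i <= N)%nat -> csimp (sq i) (Nat.iter i g y)) -> osimp s y)).
  assert (HW : forall s, In s Ks -> length s = S d -> Sig (W s) /\ W s 0%nat = s /\
    forall y, (forall i, (i <= N)%nat -> csimp (W s i) (Nat.iter i g y)) -> osimp s y).
  { intros s H1 H2. unfold W. apply epsilon_spec. apply HN; auto. }
  (* A state is the simplex whose word is being read and the position in it. After position [N] the
     reading restarts from the letter at [S N], which is the first letter of its own word, so the
     transition stays admissible. *)
  set (nxt := fun p : simplex * nat =>
    if Nat.eq_dec (snd p) N then (W (fst p) (S N), 0%nat) else (fst p, S (snd p))).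
  set (st := fun i => Nat.iter i nxt (sq m, 0%nat)).
  set (cur := fun p : simplex * nat => W (fst p) (snd p)).
  assert (Hst : forall i, In (fst (st i)) Ks /\ length (fst (st i)) = S d /\ (snd (st i) <= N)%nat).
  { induction i as [|i (H1 & H2 & H3)].
    - destruct (Hsq m) as (H1 & H2 & _). simpl. split; [|split]; auto. lia.
    - change (st (S i)) with (nxt (st i)). unfold nxt.
      destruct (Nat.eq_dec (snd (st i)) N); simpl.
      + destruct (proj1 (HW _ H1 H2) (S N)) as (G1 & G2 & _). split; [|split]; auto. lia.
      + split; [|split]; auto. lia. }
  assert (Hcur : forall i, In (cur (st i)) Ks /\ length (cur (st i)) = S d /\
                   Gstar K gam (cur (st i)) (cur (st (S i)))).
  { intros i. destruct (Hst i) as (H1 & H2 & H3).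
    destruct (proj1 (HW _ H1 H2) (snd (st i))) as (G1 & G2 & G3).
    split; [|split]; auto. change (st (S i)) with (nxt (st i)). unfold nxt, cur.
    destruct (Nat.eq_dec (snd (st i)) N) as [E|]; simpl; auto.
    rewrite E in *. destruct (proj1 (HW _ H1 H2) (S N)) as (F1 & F2 & _).
    rewrite (proj1 (proj2 (HW _ F1 F2))). auto. }
  assert (Hrun : forall j i, snd (st j) = 0%nat -> (i <= N)%nat -> st (i + j)%nat = (fst (st j), i)).
  { intros j i H0. induction i as [|i IH]; intros Hi.
    - simpl. rewrite <- H0. apply surjective_pairing.
    - change (st (S i + j)%nat) with (nxt (st (i + j)%nat)). rewrite IH by lia.
      unfold nxt; simpl. destruct (Nat.eq_dec i N); [lia|auto]. }
  (* Restarts occur arbitrarily late; [q] bounds the letters left in the current word. *)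
  assert (Hrestart : forall q j, (N - snd (st j) <= q)%nat ->
            exists j', (j <= j')%nat /\ snd (st j') = 0%nat).
  { assert (Hend : forall j, snd (st j) = N -> snd (st (S j)) = 0%nat).
    { intros j E. change (st (S j)) with (nxt (st j)). unfold nxt.
      destruct (Nat.eq_dec (snd (st j)) N); [auto|congruence]. }
    induction q as [|q IH]; intros j Hq; destruct (Hst j) as (_ & _ & H3).
    - exists (S j). split; [lia|]. apply Hend. lia.
    - destruct (Nat.eq_dec (snd (st j)) N) as [E|E].
      + exists (S j). split; [lia|]. auto.
      + destruct (IH (S j)) as (j' & Hj & Hj').
        { change (st (S j)) with (nxt (st j)). unfold nxt.
          destruct (Nat.eq_dec (snd (st j)) N); [congruence|]. simpl. lia. }
        exists j'. split; auto. lia. }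
  (* The first trapping word begins with [sq m], so the junction at time [m] is admissible. *)
  set (tq := fun i => if lt_dec i m then sq i else cur (st (i - m)%nat)).
  assert (Htail : forall i, tq (i + m)%nat = cur (st i)).
  { intros i. unfold tq. destruct (lt_dec (i + m) m); [lia|]. do 2 f_equal. lia. }
  assert (Htq : Sig tq).
  { intros i. destruct (le_lt_dec m i) as [Hle|Hlt].
    - replace i with ((i - m) + m)%nat by lia.
      change (S (i - m + m)) with (S (i - m) + m)%nat. rewrite !Htail. apply Hcur.
    - assert (E : tq (S i) = sq (S i)).
      { unfold tq. destruct (lt_dec (S i) m); auto.
        replace (S i) with m by lia. replace (m - m)%nat with 0%nat by lia.
        destruct (Hsq m) as (H1 & H2 & _). apply (HW _ H1 H2). }
      rewrite E. unfold tq. destruct (lt_dec i m); [|lia]. apply (Hsq i). }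
  exists tq. split; [auto|split].
  - intros i Hi. unfold tq. destruct (lt_dec i m); [auto|lia].
  - intros y Hy i.
    destruct (Hrestart N i) as (j & Hij & Hj); [lia|].
    (* At the restart time [j + m] the orbit is trapped in an open simplex, and openness is carried
       back to time [i]. *)
    apply (interior_back_iter tq y (j + m - i)); auto.
    replace (j + m - i + i)%nat with (j + m)%nat by lia.
    destruct (Hst j) as (H1 & H2 & _). destruct (HW _ H1 H2) as (_ & E0 & Htrap).
    rewrite Htail. unfold cur. rewrite Hj, E0. apply Htrap. intros r Hr.
    rewrite <- Nat.iter_add.
    replace (W (fst (st j)) r) with (tq (r + (j + m))%nat); [apply Hy|].
    rewrite Nat.add_assoc, Htail, Hrun; auto.
Qed.

End Dynamics.

Theorem theorem4p10 (n d : nat) (K Ks : list simplex) (gam g : pt -> pt) :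
  (1 <= d)%nat ->
  sc_complex n K -> everywhere_dim d K ->
  pl_subdivision n Ks K -> proper_sub Ks K ->
  simplicial_map Ks K gam -> nondegenerate Ks K gam ->
  assoc_pl Ks gam g ->
  exists h : (nat -> simplex) -> pt,
    (* H_gamma is the graph of h on ^dK*_{G*} *)
    (forall sq, Sigma d Ks K gam sq -> forall x, Hgam K g sq x <-> x = h sq) /\
    (* onto X *)
    (forall x, polyh K x -> exists sq, Sigma d Ks K gam sq /\ h sq = x) /\
    (* continuous (product topology on the domain, Euclidean on X) *)
    (forall sq, Sigma d Ks K gam sq -> forall eps, 0 < eps ->
       exists m, forall tq, Sigma d Ks K gam tq -> agree m sq tq ->
         edist n (h sq) (h tq) < eps) /\
    (* almost one-to-one: points with singleton fibre are dense *)
    (forall sq, Sigma d Ks K gam sq -> forall m,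
       exists tq, Sigma d Ks K gam tq /\ agree m sq tq /\
         forall uq, Sigma d Ks K gam uq -> h uq = h tq -> uq = tq) /\
    (* semiconjugacy H o S = g o H *)
    (forall sq, Sigma d Ks K gam sq -> h (shift sq) = g (h sq)).
Proof.
  intros _ HK Hdim Hsub Hprop Hsim Hnondeg Hpl.
  pose proof (proj1 Hsub) as HKs.
  destruct (uniform_overlap n K Ks HK HKs Hprop) as (k & Hk & Hoverlap).
  (* The coded point; the origin only witnesses that the type of points is inhabited. *)
  set (h := fun sq => epsilon (inhabits (fun _ : nat => 0)) (fun x => Hgam K g sq x)).
  assert (Hh : forall sq, Sigma d Ks K gam sq -> Hgam K g sq (h sq)).
  { intros sq Hsq. unfold h. apply epsilon_spec.
    eapply itinerary_point; eauto. }
  assert (Huniq : forall sq, Sigma d Ks K gam sq -> forall x,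
            (forall i, csimp (sq i) (Nat.iter i g x)) -> x = h sq).
  { intros sq Hsq x Hx. destruct (Hh sq Hsq) as [_ Hy].
    apply (itinerary_point_unique n d K Ks gam g HK Hsub Hnondeg Hpl k Hk Hoverlap sq); auto. }
  exists h. split; [|split; [|split; [|split]]].
  - intros sq Hsq x. split; [|intros ->; auto]. intros [_ Hx]. auto.
  - intros x Hx. destruct (in_top_simplex n d K x HK Hdim Hx) as (t & Ht & Hl & Hxt).
    destruct (subdivision_top_simplex n K Ks t x HK Hsub Ht Hxt) as (s & Hs & Hls & _ & Hxs).
    destruct (itinerary_exists n d K Ks gam g HK Hsub Hsim Hnondeg Hpl s x Hs)
      as (sq & Hsq & _ & Hit); auto; [congruence|].
    exists sq. split; auto. symmetry. auto.
  - intros sq Hsq eps Heps.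
    destruct (itinerary_continuous n d K Ks gam g HK Hsub Hnondeg Hpl k Hk Hoverlap
                sq (h sq) eps Hsq (Hh sq Hsq) Heps) as (m & Hm).
    exists m. intros tq Htq Hag. apply (Hm tq); auto.
  - intros sq Hsq m.
    destruct (generic_extension n d K Ks gam g HK Hsub Hsim Hnondeg Hpl k Hk Hoverlap sq m Hsq)
      as (tq & Htq & Hag & Hopen).
    exists tq. split; [|split]; auto. intros uq Huq E.
    apply functional_extensionality; intros i.
    destruct (Hh tq Htq) as [_ Ht]. destruct (Hh uq Huq) as [_ Hu]. rewrite E in Hu.
    symmetry. destruct (Htq i) as (H1 & H2 & _). destruct (Huq i) as (H3 & H4 & _).
    (* The i-th iterate is interior to [tq i] and lies in [uq i], a simplex of the same
       dimension. *)
    apply (interior_unique n Ks _ _ (Nat.iter i g (h tq))); auto. lia.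
  - intros sq Hsq. symmetry. destruct (Hh sq Hsq) as [_ Hx].
    (* The point [g (h sq)] follows the shifted itinerary, so uniqueness identifies it. *)
    apply Huniq; [apply Sigma_shift; auto|].
    intros i. rewrite iter_shift. apply (Hx (S i)).
Qed.
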